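(* Let $\mathcal{B}$ be a finite relational structure such that \textsc{Max-CSP}$(\mathcal{B})$ is either in PO or APX-complete. Then \textsc{Max-Sur-CSP}$(\mathcal{B})$ is either in PTAS or APX-complete.
   Context: For a finite relational signature $\sigma$ with relation symbols $R_1,\dots,R_m$ of arities $k_1,\dots,k_m$, a finite $\sigma$-structure $\mathcal{A}=(A,R_1^{\mathcal{A}},\dots,R_m^{\mathcal{A}})$ consists of a finite set $A$ and relations $R_i^{\mathcal{A}}\subseteq A^{k_i}$; its size is $|\mathcal{A}|=|A|+\sum_i|R_i^{\mathcal{A}}|$. For a fixed finite $\sigma$-structure $\mathcal{B}$, \textsc{Max-CSP}$(\mathcal{B})$ takes as input a finite $\sigma$-structure $\mathcal{A}$ and asks for a function $h:A\to B$ maximizing the number of pairs $(i,(a_1,\dots,a_{k_i}))$ with $(a_1,\dots,a_{k_i})\in R_i^{\mathcal{A}}$ and $(h(a_1),\dots,h(a_{k_i}))\in R_i^{\mathcal{B}}$. \textsc{Max-Sur-CSP}$(\mathcal{B})$ is the same problem restricted to instances with $|A|\geq|B|$ and requiring $h$ to be surjective. A solution with value $Val$ is $r$-approximate if $Val/Opt\geq r$. PO: an optimal solution can be computed in polynomial time. PTAS: there is an algorithm which, given an instance $\mathcal{I}$ and a fixed rational $\epsilon>0$, outputs a $(1-\epsilon)$-approximate solution in time polynomial in $|\mathcal{I}|$. APX: for some constant $r\in(0,1]$ there is a polynomial-time algorithm outputting $r$-approximate solutions. $\Pi_1$ is AP-reducible to $\Pi_2$ if there are polynomial-time computable $F,G$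 and a constant $\alpha$ such that $F$ maps instances of $\Pi_1$ to instances of $\Pi_2$, $G(\mathcal{I},s')$ maps feasible solutions of $F(\mathcal{I})$ to feasible solutions of $\mathcal{I}$, and if $s'$ is $r$-approximate ($r\leq 1$) then $G(\mathcal{I},s')$ is $(1-(1-r)\alpha-o(1))$-approximate. APX-hard: every problem in APX is AP-reducible to it. APX-complete: in APX and APX-hard. *)

(* Defs.v *)
From Corelib Require Import PosDef.
From mathcomp Require Import all_boot all_order all_algebra.

Set Implicit Arguments.
Unset Strict Implicit.
Unset Printing Implicit Defensive.

Import Order.TTheory GRing.Theory Num.Theory.

(** * Model of computation *)

(** Programs are those of the structured WHILE language over binary trees
    (N. D. Jones, "Computability and Complexity from a Programming Perspective")
    in its one-variable form: the store is a single tree. *)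

Inductive tree : Type := Leaf | Node of tree & tree.

Fixpoint tree_size (x : tree) : nat :=
  if x is Node a b then (tree_size a + tree_size b).+1 else 1.

Inductive prog : Type :=
| PId
| PLeaf
| PFst
| PSnd
| PPair of prog & prog
| PSeq of prog & prog
| PIf of prog & prog & prog
| PWhile of prog & prog.

(** [run p x y t]: on input [x], the program [p] halts with output [y] at cost
    [t]; [Leaf] stands for false in tests.  Every primitive step is charged the
    size of the tree it reads, so that [t] bounds the sizes of all the trees
    occurring in the computation and this cost agrees with Turing machine time
    up to a polynomial (with unit costs, iterating [PPair PId PId] would build
    trees of exponential size in linear time). *)
Inductive run : prog -> tree -> tree -> nat -> Prop :=
| run_id x : run PId x x (tree_size x)
| run_leaf x : run PLeaf x Leaf (tree_size x)
| run_fst_leaf : run PFst Leaf Leaf 1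
| run_fst a b : run PFst (Node a b) a (tree_size (Node a b))
| run_snd_leaf : run PSnd Leaf Leaf 1
| run_snd a b : run PSnd (Node a b) b (tree_size (Node a b))
| run_pair p q x a b t u :
    run p x a t -> run q x b u -> run (PPair p q) x (Node a b) (t + u).+1
| run_seq p q x y z t u :
    run p x y t -> run q y z u -> run (PSeq p q) x z (t + u).+1
| run_if_true c p q x a b y t u :
    run c x (Node a b) t -> run p x y u -> run (PIf c p q) x y (t + u).+1
| run_if_false c p q x y t u :
    run c x Leaf t -> run q x y u -> run (PIf c p q) x y (t + u).+1
| run_while_stop c p x t :
    run c x Leaf t -> run (PWhile c p) x x t.+1
| run_while_step c p x a b y z t u v :
    run c x (Node a b) t -> run p x y u -> run (PWhile c p) y z v ->
    run (PWhile c p) x z (t + u + v).+1.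

(** Every polynomial with natural coefficients is dominated by some [pbound k]. *)
Definition pbound (k n : nat) : nat := k * n ^ k + k.

(** [p] maps [x] to [y] in time at most [pbound k n]. *)
Definition runs_within (p : prog) (k n : nat) (x y : tree) : Prop :=
  exists2 t, run p x y t & t <= pbound k n.

(** * Encodings of data as trees *)

Definition enc_bool (b : bool) : tree := if b then Node Leaf Leaf else Leaf.

Definition enc_seq (T : Type) (enc : T -> tree) (s : seq T) : tree :=
  foldr (fun x d => Node (enc x) d) Leaf s.

Definition enc_unary (n : nat) : tree := iter n (Node Leaf) Leaf.

(** Binary numerals: lists of bits, least significant bit first. *)
Fixpoint enc_pos (n : positive) : tree :=
  match n with
  | xH => Node (enc_bool true) Leaf
  | xO n => Node (enc_bool false) (enc_pos n)
  | xI n => Node (enc_bool true) (enc_pos n)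
  end.

Definition enc_binary (n : nat) : tree :=
  if bin_of_nat n is Npos p then enc_pos p else Leaf.

(** Only used for nonnegative rationals. *)
Definition enc_rat (q : rat) : tree :=
  Node (enc_binary `|numq q|%N) (enc_binary `|denq q|%N).

(** * Maximization problems *)

Record problem := Problem {
  inst : Type;
  isize : inst -> nat;
  enc_inst : inst -> tree;
  sol : inst -> Type;
  enc_sol : forall I : inst, sol I -> tree;
  value : forall I : inst, sol I -> nat
}.

Arguments isize {p} I.
Arguments enc_inst {p} I.
Arguments sol {p} I.
Arguments enc_sol {p I} s.
Arguments value {p I} s.

Definition is_opt (P : problem) (I : inst P) (v : nat) : Prop :=
  (exists s : sol I, value s = v) /\ (forall s : sol I, value s <= v).

Definition optimal (P : problem) (I : inst P) (s : sol I) : Prop :=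
  is_opt I (value s).

(** Val / Opt >= r, multiplied out so that Opt = 0 is meaningful: every solution
    is then optimal, and [r]-approximate for every [r]. *)
Definition approximate (P : problem) (r : rat) (I : inst P) (s : sol I) : Prop :=
  exists2 v : nat, is_opt I v & (r * v%:R <= (value s)%:R)%R.

(** NP optimization problems: instances and solutions have faithful encodings
    and are recognizable in polynomial time, solutions have polynomial length,
    values (written in binary) are computable in polynomial time, and the
    instance size [isize] is polynomially related to the length of encodings. *)
Record NPO (P : problem) : Prop := {
  npo_enc_inst_inj : injective (@enc_inst P);
  npo_enc_sol_inj : forall I : inst P, injective (@enc_sol P I);
  npo_isize : exists k, forall I : inst P,
    tree_size (enc_inst I) <= pbound k (isize I) /\
    isize I <= pbound k (tree_size (enc_inst I));
  npo_inst : exists p k, forall d : tree, exists b : bool,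
    runs_within p k (tree_size d) d (enc_bool b) /\
    (b <-> exists I : inst P, enc_inst I = d);
  npo_sol_size : exists k, forall (I : inst P) (s : sol I),
    tree_size (enc_sol s) <= pbound k (isize I);
  npo_sol : exists p k, forall (I : inst P) (d : tree), exists b : bool,
    runs_within p k (isize I + tree_size d) (Node (enc_inst I) d) (enc_bool b) /\
    (b <-> exists s : sol I, enc_sol s = d);
  npo_value : exists p k, forall (I : inst P) (s : sol I),
    runs_within p k (isize I) (Node (enc_inst I) (enc_sol s))
      (enc_binary (value s))
}.

Definition PO (P : problem) : Prop :=
  NPO P /\
  exists p k, forall I : inst P, exists2 s : sol I,
    runs_within p k (isize I) (enc_inst I) (enc_sol s) & optimal s.

(** One algorithm for all [eps]; the polynomial may depend on [eps]. *)
Definition PTAS (P : problem) : Prop :=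
  NPO P /\
  exists p, forall eps : rat, (0 < eps)%R ->
    exists k, forall I : inst P, exists2 s : sol I,
      runs_within p k (isize I) (Node (enc_inst I) (enc_rat eps)) (enc_sol s)
      & approximate (1 - eps)%R s.

(** Here and below, real constants may be taken rational without loss of
    generality: decreasing [r], or increasing the constant of a reduction or its
    o(1) term, preserves the definitions. *)
Definition APX (P : problem) : Prop :=
  NPO P /\
  exists2 r : rat, (0 < r <= 1)%R &
    exists p k, forall I : inst P, exists2 s : sol I,
      runs_within p k (isize I) (enc_inst I) (enc_sol s) & approximate r s.

Definition vanishing (e : nat -> rat) : Prop :=
  forall delta : rat, (0 < delta)%R ->
    exists N, forall n, N <= n -> (`|e n| < delta)%R.

Definition AP_reducible (P Q : problem) : Prop :=
  exists (F : inst P -> inst Q) (G : forall I : inst P, sol (F I) -> sol I)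
         (alpha : rat) (e : nat -> rat),
  [/\ exists p k, forall I : inst P,
        runs_within p k (isize I) (enc_inst I) (enc_inst (F I)),
      exists p k, forall (I : inst P) (s' : sol (F I)),
        runs_within p k (isize I + tree_size (enc_sol s'))
          (Node (enc_inst I) (enc_sol s')) (enc_sol (G I s')),
      vanishing e
    & forall (I : inst P) (s' : sol (F I)) (r : rat), (r <= 1)%R ->
        approximate r s' ->
        approximate (1 - (1 - r) * alpha - e (isize I))%R (G I s')].

Definition APX_hard (P : problem) : Prop :=
  forall Q : problem, APX Q -> AP_reducible Q P.

Definition APX_complete (P : problem) : Prop := APX P /\ APX_hard P.

(** * Relational structures *)

Record signature := Signature {
  nsym : nat;
  arity : 'I_nsym -> nat
}.

Record structure (sigma : signature) := Structure {
  dom :> finType;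
  rel_of : forall i : 'I_(nsym sigma), {set (arity i).-tuple dom}
}.

Definition ssize (sigma : signature) (A : structure sigma) : nat :=
  #|A| + \sum_i #|rel_of A i|.

Definition csp_value (sigma : signature) (A B : structure sigma)
    (h : {ffun A -> B}) : nat :=
  \sum_i #|[set t in rel_of A i | map_tuple h t \in rel_of B i]|.

(** An input structure is presented on a domain {0, ..., n-1} by listing the
    tuples of each relation without repetition, in any order. *)
Record listing (sigma : signature) := Listing {
  ldom : nat;
  lrel : forall i : 'I_(nsym sigma), seq ((arity i).-tuple 'I_ldom);
  lrel_uniq : [forall i, uniq (lrel i)]
}.

Definition struct_of (sigma : signature) (L : listing sigma) : structure sigma :=
  @Structure sigma 'I_(ldom L) (fun i => [set t in lrel L i]).

Definition enc_listing (sigma : signature) (L : listing sigma) : tree :=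
  Node (enc_unary (ldom L))
    (enc_seq (fun i => enc_seq (enc_seq (fun a : 'I_(ldom L) => enc_unary a))
                         (map val (lrel L i)))
             (enum 'I_(nsym sigma))).

Definition enc_map (n : nat) (B : finType) (h : {ffun 'I_n -> B}) : tree :=
  enc_seq (fun a => enc_unary (enum_rank (h a))) (enum 'I_n).

Definition Max_CSP (sigma : signature) (B : structure sigma) : problem :=
  {| inst := listing sigma;
     isize := fun L => ssize (struct_of L);
     enc_inst := @enc_listing sigma;
     sol := fun L => {ffun struct_of L -> B};
     enc_sol := fun L h => enc_map h;
     value := fun L h => csp_value h |}.

Definition surjective (A B : finType) (h : {ffun A -> B}) : bool :=
  [forall b, exists a, h a == b].

Definition Max_Sur_CSP (sigma : signature) (B : structure sigma) : problem :=
  {| inst := {L : listing sigma | #|B| <= #|struct_of L|};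
     isize := fun L => ssize (struct_of (val L));
     enc_inst := fun L => enc_listing (val L);
     sol := fun L => {h : {ffun struct_of (val L) -> B} | surjective h};
     enc_sol := fun L h => enc_map (val h);
     value := fun L h => csp_value (val h) |}.

(* Main.v *)
From HB Require Import structures.
From Corelib Require Import PosDef.
From mathcomp Require Import all_boot all_order all_algebra.
From mathcomp Require Import zify lra.
Require Import Defs.

(** An algorithm for [Max_CSP B] is turned into one for [Max_Sur_CSP B] by
    overwriting its solution [h] on a window of [#|B|] consecutive elements of
    the instance with an enumeration of [B], and keeping the best of the
    resulting maps.  An element lies in at most [#|B|] of the [n - #|B| + 1]
    windows, so on average a window destroys only a fraction [O(1/n)] of the
    tuples satisfied by [h]; hence the ratio drops by at most [eps] as soon as
    [n] exceeds a threshold [O(1/eps)], and below this threshold exhaustive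
    search takes constant time for fixed [eps].  This gives the PTAS in the PO
    case and membership in APX in the other case.  For hardness, adding [#|B|]
    isolated elements to an instance makes surjectivity free, so that it
    reduces [Max_CSP B] to [Max_Sur_CSP B] without loss. *)

Set Implicit Arguments.
Unset Strict Implicit.
Unset Printing Implicit Defensive.

Import Order.TTheory GRing.Theory Num.Theory.

(** * Polynomial-time transformations *)

(** Polynomial time is a statement about concrete programs, so every algorithm has to be built as
    one. [ptime D sz a b] states that a single program takes [a z] to [b z] for all indices [z] in
    [D]. The index may hold data absent from the input, such as the solution that a given program
    returns, and [D] records what is known of it. Closure rules for projections, tests and folds
    spare almost all explicit programs. A tuple of arity k meets at most k * #|B| windows, so on
    average at most a fraction #|B| * K / W of the value is lost, with K the sum of the arities and
    W the number of windows. As eps is at least 1/d for its denominator d, it suffices that W >=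
    #|B| * K * d. The threshold replaces d by a power of two, which repeated doubling writes in
    unary without a program for multiplication. The surjective optimum is at most the optimum of
    [Max_CSP B], so the given solution may be measured against the latter. The resulting guarantee r
    - eps covers both cases: r = 1 with any eps, and eps = r / 2. *)

Lemma tree_size_gt0 x : 0 < tree_size x.
Proof. by case: x. Qed.

(** Reading is charged by size, so a time bound is also a size bound. This is how the output sizes
    of composed programs are controlled. *)
Lemma run_size p x y t : run p x y t -> tree_size x <= t /\ tree_size y <= t.
Proof.
elim=> {p x y t} //=; intros;
  repeat match goal with H : _ /\ _ |- _ => case: H => ? ? end; split.
all: try exact: tree_size_gt0; try lia.
Qed.

(** * Polynomially bounded functions *)

Section Polynomial.
Variables (Z : Type) (D : Z -> Prop) (sz : Z -> nat).

(** The base is at least 2, so constants and sums are absorbed into the single exponent. *)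
Definition pbd (f : Z -> nat) : Prop :=
  exists k, forall z, D z -> f z <= (sz z + 2) ^ k.

Lemma pbd_le g f : pbd g -> (forall z, D z -> f z <= g z) -> pbd f.
Proof.
by move=> [k gk] fg; exists k => z Dz; apply: leq_trans (fg z Dz) (gk z Dz).
Qed.

Lemma pbd_const c : pbd (fun=> c).
Proof.
by exists c => z _; apply/ltnW/ltn_expl; rewrite addn2.
Qed.

Lemma pbd_sz : pbd sz.
Proof. by exists 1 => z _; rewrite expn1 leq_addr. Qed.

Lemma pbd_mul f g : pbd f -> pbd g -> pbd (fun z => f z * g z).
Proof.
move=> [k fk] [l gl]; exists (k + l) => z Dz.
by rewrite expnD leq_mul ?fk ?gl.
Qed.

Lemma pbd_add f g : pbd f -> pbd g -> pbd (fun z => f z + g z).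
Proof.
move=> [k fk] [l gl]; exists (k + l).+1 => z Dz.
have := fk z Dz; have := gl z Dz; rewrite expnS expnD.
have: 0 < (sz z + 2) ^ k by rewrite expn_gt0 addn2.
have: 0 < (sz z + 2) ^ l by rewrite expn_gt0 addn2.
nia.
Qed.

Lemma pbd_exp f c : pbd f -> pbd (fun z => f z ^ c).
Proof.
move=> bf; elim: c => [|c IH]; first exact: pbd_const.
by apply: (pbd_le (pbd_mul bf IH)) => z _; rewrite expnS.
Qed.

Lemma pbd_pbound f k : pbd f -> pbd (fun z => pbound k (f z)).
Proof.
move=> bf; apply: pbd_add (pbd_const k).
exact: pbd_mul (pbd_const k) (pbd_exp k bf).
Qed.

Lemma pbd_pboundP f :
  pbd f <-> exists k, forall z, D z -> f z <= pbound k (sz z).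
Proof.
split=> [[k fk]|[k fk]]; last exact: pbd_le (pbd_pbound k pbd_sz) fk.
(* For n > 0, (n + 2)^k <= (3n)^k = 3^k * n^k, and k <= 3^k allows the larger exponent. For n = 0
   the additive constant of [pbound] exceeds 2^k. *)
exists (3 ^ k) => z /fk /leq_trans; apply; rewrite /pbound.
have lek : k <= 3 ^ k by apply/ltnW/ltn_expl.
case: (sz z) => [|n].
  by apply: leq_trans (leq_addl _ _); case: (k) => // j; rewrite leq_exp2r.
apply: leq_trans (leq_addr _ _).
apply: (@leq_trans ((3 * n.+1) ^ k)).
  by case: (k) => // j; rewrite leq_exp2r //; lia.
by rewrite expnMn leq_mul2l leq_pexp2l ?orbT.
Qed.

End Polynomial.

Lemma pbd_reindex (Y Z : Type) (D : Z -> Prop) (sz : Z -> nat)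
    (D' : Y -> Prop) (sz' : Y -> nat) (g : Y -> Z) f :
  pbd D sz f -> (forall y, D' y -> D (g y)) ->
  pbd D' sz' (fun y => sz (g y)) -> pbd D' sz' (fun y => f (g y)).
Proof.
move=> [k fk] DD bg.
apply: (pbd_le (pbd_exp k (pbd_add bg (pbd_const _ _ 2)))) => y /DD.
exact: fk.
Qed.

Definition tfst x := if x is Node a _ then a else Leaf.
Definition tsnd x := if x is Node _ b then b else Leaf.

Notation tlist := (enc_seq id).

Section Transducers.
Variables (Z : Type) (D : Z -> Prop) (sz : Z -> nat).

(* [sz] need not be the size of the input: for the approximation scheme it is
   superpolynomial in the size of [eps], so that one program has a polynomial time
   bound for each fixed [eps]. *)
Definition ptime (a b : Z -> tree) : Prop :=
  exists p T, pbd D sz T /\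
    forall z, D z -> exists2 t, run p (a z) (b z) t & t <= T z.

Definition psize (a : Z -> tree) : Prop := pbd D sz (fun z => tree_size (a z)).

Lemma ptime_runs a b :
  ptime a b <->
  exists p k, forall z, D z -> runs_within p k (sz z) (a z) (b z).
Proof.
split=> [[p [T [/pbd_pboundP[k Tk] pT]]]|[p [k pk]]].
  exists p, k => z Dz; have [t rt tT] := pT z Dz.
  by exists t => //; apply: leq_trans tT (Tk z Dz).
by exists p, (fun z => pbound k (sz z)); split=> //; apply/pbd_pbound/pbd_sz.
Qed.

Lemma ptime_psize a b : ptime a b -> psize b.
Proof.
move=> [p [T [bT pT]]]; apply: pbd_le bT _ => z /pT[t /run_size[_ le] tT].
exact: leq_trans le tT.
Qed.

Lemma ptime_ext a b c : ptime a b -> (forall z, D z -> b z = c z) -> ptime a c.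
Proof.
move=> [p [T [bT pT]]] bc; exists p, T; split=> // z Dz.
by rewrite -bc //; apply: pT.
Qed.

Lemma ptime_ext_in a a' b :
  ptime a b -> (forall z, D z -> a z = a' z) -> ptime a' b.
Proof.
move=> [p [T [bT pT]]] aa; exists p, T; split=> // z Dz.
by rewrite -aa //; apply: pT.
Qed.

Lemma ptime_id a : psize a -> ptime a a.
Proof.
move=> sa; exists PId, (fun z => tree_size (a z)); split=> // z Dz.
by exists (tree_size (a z)) => //; constructor.
Qed.

Lemma ptime_refl a b : ptime a b -> ptime a a.
Proof.
move=> [p [T [bT pT]]]; apply/ptime_id/(pbd_le bT) => z /pT[t].
by move=> /run_size[le _] tT; exact: leq_trans le tT.
Qed.

Lemma ptime_seq b a c : ptime a b -> ptime b c -> ptime a c.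
Proof.
move=> [p [T [bT pT]]] [q [U [bU qU]]].
exists (PSeq p q), (fun z => T z + U z + 1).
split; first exact: pbd_add (pbd_add bT bU) (pbd_const _ _ 1).
move=> z Dz; have [t rt tT] := pT z Dz; have [u ru uU] := qU z Dz.
by exists (t + u).+1; [apply: run_seq rt ru | lia].
Qed.

Lemma ptime_pair a b c :
  ptime a b -> ptime a c -> ptime a (fun z => Node (b z) (c z)).
Proof.
move=> [p [T [bT pT]]] [q [U [bU qU]]].
exists (PPair p q), (fun z => T z + U z + 1).
split; first exact: pbd_add (pbd_add bT bU) (pbd_const _ _ 1).
move=> z Dz; have [t rt tT] := pT z Dz; have [u ru uU] := qU z Dz.
by exists (t + u).+1; [apply: run_pair rt ru | lia].
Qed.

Lemma ptime_fst a b : ptime a b -> ptime a (fun z => tfst (b z)).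
Proof.
move=> ab; apply: (ptime_seq ab).
exists PFst, (fun z => tree_size (b z)); split; first exact: ptime_psize ab.
by move=> z Dz; exists (tree_size (b z)) => //; case: (b z) => *; constructor.
Qed.

Lemma ptime_snd a b : ptime a b -> ptime a (fun z => tsnd (b z)).
Proof.
move=> ab; apply: (ptime_seq ab).
exists PSnd, (fun z => tree_size (b z)); split; first exact: ptime_psize ab.
by move=> z Dz; exists (tree_size (b z)) => //; case: (b z) => *; constructor.
Qed.

Lemma ptime_const a c : ptime a a -> ptime a (fun=> c).
Proof.
move=> aa; elim: c => [|b IHb c IHc]; last exact: ptime_pair.
exists PLeaf, (fun z => tree_size (a z)); split; first exact: ptime_psize aa.
by move=> z Dz; exists (tree_size (a z)) => //; constructor.
Qed.

End Transducers.

Lemma ptime_reindex (Y Z : Type) (g : Y -> Z) (D : Z -> Prop) (sz : Z -> nat)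
    (D' : Y -> Prop) (sz' : Y -> nat) a b :
  ptime D sz a b -> (forall y, D' y -> D (g y)) ->
  pbd D' sz' (fun y => sz (g y)) ->
  ptime D' sz' (fun y => a (g y)) (fun y => b (g y)).
Proof.
move=> [p [T [bT pT]]] DD bg; exists p, (fun y => T (g y)).
split; first exact: pbd_reindex bT DD bg.
by move=> y /DD; apply: pT.
Qed.

Lemma ptime_sub (Z : Type) (D D' : Z -> Prop) (sz : Z -> nat) a b :
  ptime D sz a b -> (forall z, D' z -> D z) -> ptime D' sz a b.
Proof. by move=> ab DD; apply: (ptime_reindex (g := id)) ab DD (pbd_sz _ _). Qed.

Lemma ptime_andl (Z : Type) (D D' : Z -> Prop) (sz : Z -> nat) a b :
  ptime D sz a b -> ptime (fun z => D z /\ D' z) sz a b.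
Proof. by move/ptime_sub; apply=> z []. Qed.
Arguments ptime_andl {Z D D' sz a b}.

(** * Branching and loops *)

Section Control.
Variables (Z : Type) (D : Z -> Prop) (sz : Z -> nat).

Lemma ptime_if (t : Z -> bool) a b c :
  ptime D sz a (fun z => enc_bool (t z)) ->
  ptime (fun z => D z /\ t z) sz a b ->
  ptime (fun z => D z /\ ~~ t z) sz a c ->
  ptime D sz a (fun z => if t z then b z else c z).
Proof.
move=> [p [T [bT pT]]] [q [U [[k kU] qU]]] [r [V [[l lV] rV]]].
(* The bounds [U] and [V] hold only where the guard takes the matching value. The explicit powers
   dominating them are polynomial on all of [D]. *)
have bpow j : pbd D sz (fun z => (sz z + 2) ^ j) by exists j.
exists (PIf p q r), (fun z => T z + (sz z + 2) ^ k + (sz z + 2) ^ l + 1).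
split; first by do 3?apply: pbd_add => //; apply: pbd_const.
move=> z Dz; have [n rn nT] := pT z Dz.
case: ifPn rn => tz rn.
  have [u ru uU] := qU z (conj Dz tz); have := kU z (conj Dz tz).
  by exists (n + u).+1; [apply: run_if_true rn ru | lia].
have [u ru uU] := rV z (conj Dz tz); have := lV z (conj Dz tz).
by exists (n + u).+1; [apply: run_if_false rn ru | lia].
Qed.

(** The cost of a round is bounded in terms of [sz z] alone, not of the size of the current state,
    so bounds do not compound over the rounds. The same [N z] bounds each state, being the initial
    tree or the output of a round. *)
Lemma ptime_while (st : Z -> nat -> tree) (n : Z -> nat) a :
  pbd D sz n -> ptime D sz a (fun z => st z 0) ->
  (forall z i, D z -> i < n z -> tfst (st z i) <> Leaf) ->
  (forall z, D z -> tfst (st z (n z)) = Leaf) ->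
  ptime (fun y : Z * nat => D y.1 /\ y.2 < n y.1) (fun y => sz y.1)
    (fun y => st y.1 y.2) (fun y => st y.1 y.2.+1) ->
  ptime D sz a (fun z => st z (n z)).
Proof.
move=> bn [p [T [bT pT]]] st_lt st_n [q [U [[k kU] qU]]].
pose N z := T z + (sz z + 2) ^ k.
have bN : pbd D sz N by apply: pbd_add => //; exists k.
have fst_st z i : run PFst (st z i) (tfst (st z i)) (tree_size (st z i)).
  by case: (st z i) => *; constructor.
have qN z i : D z -> i < n z ->
    exists2 t, run q (st z i) (st z i.+1) t & t <= N z.
  move=> Dz lt_in; have [t rt tU] := qU (z, i) (conj Dz lt_in).
  exists t => //; apply: leq_trans tU _.
  by have := kU (z, i) (conj Dz lt_in); rewrite /N /=; lia.
have stN z i : D z -> i <= n z -> tree_size (st z i) <= N z.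
  move=> Dz; case: i => [_|i lt_in].
    have [t /run_size[_ le] tT] := pT z Dz.
    by apply: leq_trans (leq_trans le tT) _; rewrite leq_addr.
  by have [t /run_size[_ le] tN] := qN z i Dz lt_in; apply: leq_trans le tN.
(* The induction is on the number of rounds left, because [run_while_step] ends with the run of the
   remaining loop. *)
have loop z m : D z -> m <= n z -> exists2 t,
    run (PWhile PFst q) (st z (n z - m)) (st z (n z)) t &
    t <= m * (N z + N z + 1) + N z + 1.
  move=> Dz; elim: m => [_|m IH lt_mn].
    exists (tree_size (st z (n z))).+1.
      rewrite subn0; apply: run_while_stop.
      by rewrite -[X in run _ _ X](st_n z Dz).
    by have := stN z (n z) Dz (leqnn _); lia.
  have [t rt tN] := IH (ltnW lt_mn).
  have lt_in : n z - m.+1 < n z by lia.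
  have [u ru uN] := qN z _ Dz lt_in.
  have iS : (n z - m.+1).+1 = n z - m by lia.
  rewrite iS in ru.
  exists (tree_size (st z (n z - m.+1)) + u + t).+1; last first.
    by have := stN z _ Dz (ltnW lt_in); nia.
  have := fst_st z (n z - m.+1).
  case E: (tfst _) => [|b c] rf; first by have := st_lt z _ Dz lt_in.
  exact: run_while_step rf ru rt.
exists (PSeq p (PWhile PFst q)),
  (fun z => T z + (n z * (N z + N z + 1) + N z + 1) + 1).
split.
  do !(apply: pbd_add || apply: pbd_mul) => //; exact: pbd_const.
move=> z Dz; have [t rt tT] := pT z Dz.
have [u ru uN] := loop z (n z) Dz (leqnn _).
exists (t + u).+1; last by lia.
by apply: run_seq rt _; rewrite subnn in ru.
Qed.

End Control.

Lemma size_tlist s : tree_size (tlist s) = (\sum_(x <- s) (tree_size x).+1).+1.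
Proof.
by elim: s => [|x s /= ->]; rewrite ?big_nil // big_cons addnS.
Qed.

Lemma leq_size_tlist s : size s < tree_size (tlist s).
Proof.
elim: s => //= x s IH.
by have := tree_size_gt0 x; lia.
Qed.

Lemma leq_nth_tlist s i : tree_size (nth Leaf s i) <= tree_size (tlist s).
Proof.
elim: s i => [|x s IH] [|i] //=; first by lia.
by have := IH i; lia.
Qed.

Lemma leq_drop_tlist s i : tree_size (tlist (drop i s)) <= tree_size (tlist s).
Proof.
elim: s i => [|x s IH] [|i] //=.
by have := IH i; lia.
Qed.

Section Fold.
Variables (Z : Type) (D : Z -> Prop) (sz : Z -> nat).

(* [ac z i] is the accumulator after [i] steps; the program for a step only has
   to be correct on accumulators of this form. *)
Lemma ptime_fold (L : Z -> seq tree) (ac : Z -> nat -> tree) a q :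
  let D' := fun y : Z * nat => D y.1 /\ y.2 < size (L y.1) in
  let sz' := fun y : Z * nat => sz y.1 in
  let src := fun y : Z * nat =>
    Node (q y.1) (Node (nth Leaf (L y.1) y.2) (ac y.1 y.2)) in
  ptime D sz a q -> ptime D sz a (fun z => tlist (L z)) ->
  ptime D sz a (fun z => ac z 0) ->
  psize D' sz' (fun y => ac y.1 y.2) ->
  (ptime D' sz' src src -> ptime D' sz' src (fun y => ac y.1 y.2.+1)) ->
  ptime D sz a (fun z => ac z (size (L z))).
Proof.
move=> D' sz' src aq aL a0 sac step.
have sq : psize D' sz' (fun y => q y.1).
  by apply: (pbd_reindex (ptime_psize aq)) (pbd_sz _ _) => y [].
have sL : psize D' sz' (fun y => tlist (L y.1)).
  by apply: (pbd_reindex (ptime_psize aL)) (pbd_sz _ _) => y [].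
(* The unread part of the list sits in the first component, so that [PFst] is the loop test: it
   yields [Leaf] exactly when the list is exhausted. *)
pose st z i := Node (tlist (drop i (L z))) (Node (q z) (ac z i)).
have : ptime D sz a (fun z => st z (size (L z))); last first.
  by move=> /ptime_snd/ptime_snd.
have sadd f g : psize D' sz' f -> psize D' sz' g ->
    psize D' sz' (fun y => Node (f y) (g y)).
  move=> sf sg.
  apply: (pbd_le (pbd_add (pbd_add sf sg) (pbd_const _ _ 1))) => y _ /=.
  by rewrite addn1.
have sst : psize D' sz' (fun y => st y.1 y.2).
  apply: sadd (sadd _ _ sq sac); apply: (pbd_le sL) => y _; exact: leq_drop_tlist.
have stst := ptime_id sst.
have qD' := ptime_fst (ptime_snd stst).
have lD' := ptime_fst stst.
have acD' := ptime_snd (ptime_snd stst).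
have hD' : ptime D' sz' (fun y => st y.1 y.2) (fun y => nth Leaf (L y.1) y.2).
  apply: (ptime_ext (ptime_fst lD')) => -[z i] [/= _ lt_i].
  by rewrite (drop_nth Leaf lt_i).
have srcD' := ptime_pair qD' (ptime_pair hD' acD').
apply: ptime_while.
- apply: (pbd_le (ptime_psize aL)) => z _; exact/ltnW/leq_size_tlist.
- have := ptime_pair aL (ptime_pair aq a0).
  by move/ptime_ext; apply=> z _; rewrite /st drop0.
- by move=> z i _ lt_i; rewrite /st (drop_nth Leaf lt_i).
- by move=> z _; rewrite /st drop_size.
have acS := ptime_seq srcD' (step (ptime_id (ptime_psize srcD'))).
apply: ptime_ext (ptime_pair (ptime_snd lD') (ptime_pair qD' acS)) _.
by move=> [z i] [/= _ lt_i]; rewrite /st (drop_nth Leaf lt_i).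
Qed.

End Fold.

Lemma size_catrev_tlist s t :
  (tree_size (tlist (catrev s t))).+1 = tree_size (tlist s) + tree_size (tlist t).
Proof. by elim: s t => [|x s IH] t //=; rewrite IH /=; lia. Qed.

Lemma leq_take_tlist s i : tree_size (tlist (take i s)) <= tree_size (tlist s).
Proof. by elim: s i => [|x s IH] [|i] //=; rewrite ltnS leq_add2l. Qed.

Lemma catrev_rcons (T : Type) (s t : seq T) x :
  catrev (rcons s x) t = x :: catrev s t.
Proof. by rewrite -cats1 catrev_catl. Qed.

(** * List operations, Boolean connectives and tests against constants *)

Section Lists.
Variables (Z : Type) (D : Z -> Prop) (sz : Z -> nat) (a : Z -> tree).

Lemma psize_fst (T : Type) (D' : Z * T -> Prop) f :
  psize D sz f -> (forall y, D' y -> D y.1) ->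
  psize D' (fun y => sz y.1) (fun y => f y.1).
Proof. by move=> sf DD; apply: (pbd_reindex sf DD (pbd_sz _ _)). Qed.

Lemma ptime_catrev L M :
  ptime D sz a (fun z => tlist (L z)) -> ptime D sz a (fun z => tlist (M z)) ->
  ptime D sz a (fun z => tlist (catrev (L z) (M z))).
Proof.
move=> aL aM; have aa := ptime_refl aL.
pose ac z i := tlist (catrev (take i (L z)) (M z)).
have : ptime D sz a (fun z => ac z (size (L z))).
  apply: (ptime_fold aa aL).
  - by apply: (ptime_ext aM) => z; rewrite /ac take0.
  - apply: (pbd_le (pbd_add (psize_fst (ptime_psize aL) _)
      (psize_fst (ptime_psize aM) _))) => [y []|y []|[z i] _] //.
    have := size_catrev_tlist (take i (L z)) (M z).
    by have := leq_take_tlist (L z) i; rewrite /ac /=; lia.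
  - move=> src; apply: ptime_ext (ptime_snd src) _ => -[z i] [/= _ lt_i].
    by rewrite /ac (take_nth Leaf lt_i) catrev_rcons.
by move/ptime_ext; apply=> z _; rewrite /ac take_size.
Qed.

Lemma ptime_rev L :
  ptime D sz a (fun z => tlist (L z)) ->
  ptime D sz a (fun z => tlist (rev (L z))).
Proof.
move=> aL.
exact: (ptime_catrev (M := fun=> [::]) aL (ptime_const Leaf (ptime_refl aL))).
Qed.

Lemma ptime_cat L M :
  ptime D sz a (fun z => tlist (L z)) -> ptime D sz a (fun z => tlist (M z)) ->
  ptime D sz a (fun z => tlist (L z ++ M z)).
Proof.
move=> aL aM; apply: ptime_ext (ptime_catrev (ptime_rev aL) aM) _ => z _.
by rewrite catrevE revK.
Qed.

Lemma ptime_cat_const s M :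
  ptime D sz a (fun z => tlist (M z)) ->
  ptime D sz a (fun z => tlist (s ++ M z)).
Proof.
move=> aM; exact: (ptime_cat (ptime_const (tlist s) (ptime_refl aM)) aM).
Qed.

Lemma ptime_drop c L :
  ptime D sz a (fun z => tlist (L z)) ->
  ptime D sz a (fun z => tlist (drop c (L z))).
Proof.
move=> aL; elim: c => [|c IH]; first by apply: ptime_ext aL _ => z; rewrite drop0.
apply: ptime_ext (ptime_snd IH) _ => z _.
by elim: (L z) c {IH} => [|x s IHs] [|c] //=; rewrite ?drop0 ?IHs.
Qed.

Lemma ptime_and (t u : Z -> bool) :
  ptime D sz a (fun z => enc_bool (t z)) ->
  ptime (fun z => D z /\ t z) sz a (fun z => enc_bool (u z)) ->
  ptime D sz a (fun z => enc_bool (t z && u z)).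
Proof.
move=> at_ au; have aF := ptime_const Leaf (ptime_refl at_).
apply: ptime_ext (ptime_if at_ au (ptime_andl aF)) _ => z _.
by case: (t z).
Qed.

Lemma ptime_or (t u : Z -> bool) :
  ptime D sz a (fun z => enc_bool (t z)) ->
  ptime D sz a (fun z => enc_bool (u z)) ->
  ptime D sz a (fun z => enc_bool (t z || u z)).
Proof.
move=> at_ au; have aT := ptime_const (enc_bool true) (ptime_refl at_).
apply: ptime_ext (ptime_if at_ (ptime_andl aT) (ptime_andl au)) _ => z _.
by case: (t z).
Qed.

(* [ptime_if] and [ptime_and] require guards of the form [enc_bool _]. *)
Lemma ptime_is_node b :
  ptime D sz a b ->
  ptime D sz a (fun z => enc_bool (if b z is Node _ _ then true else false)).
Proof.
move=> ab; apply: (ptime_seq ab).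
exists (PIf PId (PPair PLeaf PLeaf) PLeaf), (fun z => 5 * tree_size (b z)).
split; first exact: pbd_mul (pbd_const _ _ 5) (ptime_psize ab).
move=> z Dz; have := tree_size_gt0 (b z); case: (b z) => [|u v] lt0; eexists.
- by apply: run_if_false; constructor.
- by [].
- by apply: run_if_true; [constructor|apply: run_pair; constructor].
- by move: lt0 => /=; lia.
Qed.

End Lists.

Fixpoint eqtree x y :=
  match x, y with
  | Leaf, Leaf => true
  | Node a b, Node c d => eqtree a c && eqtree b d
  | _, _ => false
  end.

Lemma eqtreeP : Equality.axiom eqtree.
Proof.
move=> x y; apply: (iffP idP) => [|<-]; last by elim: x => //= a -> b ->.
elim: x y => [|a IHa b IHb] [|c d] //= /andP[/IHa-> /IHb->] //.
Qed.

HB.instance Definition _ := hasDecEq.Build tree eqtreeP.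

Section Tests.
Variables (Z : Type) (D : Z -> Prop) (sz : Z -> nat) (a : Z -> tree).

(** The program is assembled by recursion on the fixed tree [c], which makes it free of loops. *)
Lemma ptime_eq_const c b :
  ptime D sz a b -> ptime D sz a (fun z => enc_bool (b z == c)).
Proof.
elim: c b => [|c IHc d IHd] b ab.
  have aa := ptime_refl ab.
  have aT := ptime_const (enc_bool true) aa.
  have aF := ptime_const (enc_bool false) aa.
  apply: ptime_ext (ptime_if (ptime_is_node ab) (ptime_andl aF)
    (ptime_andl aT)) _ => z _.
  by case: (b z).
have ac := IHc _ (ptime_fst ab); have ad := IHd _ (ptime_snd ab).
have acd := ptime_and ac (ptime_andl ad).
apply: ptime_ext (ptime_and (ptime_is_node ab)
  (ptime_andl acd)) _ => z _.
by case: (b z).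
Qed.

End Tests.

Section Membership.
Variables (Z : Type) (D : Z -> Prop) (sz : Z -> nat) (a : Z -> tree).

Lemma ptime_mem_const c L :
  ptime D sz a (fun z => tlist (L z)) ->
  ptime D sz a (fun z => enc_bool (c \in L z)).
Proof.
move=> aL; have aa := ptime_refl aL.
pose ac z i := enc_bool (c \in take i (L z)).
have : ptime D sz a (fun z => ac z (size (L z))).
  apply: (ptime_fold aa aL).
  - by apply: (ptime_ext (ptime_const Leaf aa)) => z; rewrite /ac take0.
  - by apply: (pbd_le (pbd_const _ _ 3)) => -[z i] _; rewrite /ac; case: (_ \in _).
  - move=> src.
    have := ptime_or (ptime_eq_const c (ptime_fst (ptime_snd src)))
      (ptime_snd (ptime_snd src)).
    move/ptime_ext; apply => -[z i] [/= _ lt_i].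
    by rewrite /ac (take_nth Leaf lt_i) mem_rcons inE eq_sym.
by move/ptime_ext; apply=> z _; rewrite /ac take_size.
Qed.

Lemma ptime_sub_const s L :
  ptime D sz a (fun z => tlist (L z)) ->
  ptime D sz a (fun z => enc_bool (all (mem (L z)) s)).
Proof.
move=> aL; elim: s => [|c s IH] /=.
  exact: ptime_const (enc_bool true) (ptime_refl aL).
exact: ptime_and (ptime_mem_const c aL) (ptime_andl IH).
Qed.

End Membership.

(** * Numerals *)

Fixpoint bitval (s : seq bool) : nat :=
  if s is b :: s' then b + (bitval s').*2 else 0.

Fixpoint pos_bits (p : positive) : seq bool :=
  match p with
  | xH => [:: true]
  | xO p => false :: pos_bits p
  | xI p => true :: pos_bits p
  end.

Definition bits (n : nat) : seq bool :=
  if bin_of_nat n is Npos p then pos_bits p else [::].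

Lemma enc_binaryE n : enc_binary n = tlist (map enc_bool (bits n)).
Proof.
rewrite /enc_binary /bits; case: (bin_of_nat n) => //.
by elim=> //= p ->.
Qed.

Lemma bits_val n : bitval (bits n) = n.
Proof.
rewrite -{2}[n]bin_of_natK /bits; case: (bin_of_nat n) => //=.
by elim=> //= p ->; rewrite NatTrec.doubleE.
Qed.

Lemma bitval_take_lt s i : bitval (take i s) < 2 ^ i.
Proof.
elim: s i => [|b s IH] [|i] //=; rewrite ?expn_gt0 // expnS.
by have := IH i; case: b; lia.
Qed.

Lemma bitval_takeS s i :
  bitval (take i.+1 s) = bitval (take i s) + nth false s i * 2 ^ i.
Proof.
elim: s i => [|b s IH] [|i] //=; first by rewrite take0 /=; lia.
by rewrite IH expnS; lia.
Qed.

(** Bit i weighs more than all lower bits together, so it decides the comparison unless both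
    numerals agree there. A single pass from the least significant bit therefore suffices. *)
Lemma leq_bitval_takeS s t i :
  (bitval (take i.+1 s) <= bitval (take i.+1 t)) =
    if nth false s i then nth false t i && (bitval (take i s) <= bitval (take i t))
    else nth false t i || (bitval (take i s) <= bitval (take i t)).
Proof.
rewrite !bitval_takeS; have := bitval_take_lt s i; have := bitval_take_lt t i.
by case: (nth _ s i); case: (nth _ t i) => /=; lia.
Qed.

Section Compare.
Variables (Z : Type) (D : Z -> Prop) (sz : Z -> nat) (a : Z -> tree).

Lemma tfst_drop (s : seq tree) i : tfst (tlist (drop i s)) = nth Leaf s i.
Proof. by elim: s i => [|b s IH] [|i] //=; rewrite ?IH. Qed.

Lemma tsnd_drop (s : seq tree) i : tsnd (tlist (drop i s)) = tlist (drop i.+1 s).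
Proof. by elim: s i => [|b s IH] [|i] //=; rewrite ?IH ?drop0. Qed.

Lemma ptime_leq_bitval s t :
  ptime D sz a (fun z => tlist (map enc_bool (s z))) ->
  ptime D sz a (fun z => tlist (map enc_bool (t z))) ->
  ptime D sz a (fun z => enc_bool (bitval (s z) <= bitval (t z))).
Proof.
move=> as_ at_; have aa := ptime_refl as_.
pose r z i := enc_bool (bitval (take i (s z)) <= bitval (take i (t z))).
pose ac z i := Node (Node (tlist (map enc_bool (drop i (s z))))
                          (tlist (map enc_bool (drop i (t z))))) (r z i).
(* This list is only a counter at least as long as either numeral. Past the end of a numeral the
   head of [Leaf] is [Leaf], which is the bit false. *)
pose L z := map enc_bool (s z) ++ map enc_bool (t z).
have : ptime D sz a (fun z => ac z (size (L z))).
  apply: (ptime_fold aa (ptime_cat as_ at_)).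
  - have := ptime_pair (ptime_pair as_ at_) (ptime_const (enc_bool true) aa).
    by move/ptime_ext; apply=> z _; rewrite /ac /r !drop0 !take0.
  - apply: (pbd_le (pbd_add (pbd_add (psize_fst (ptime_psize as_) _)
      (psize_fst (ptime_psize at_) _)) (pbd_const _ _ 5))) =>
      [y []|y []|[z i] _] //=.
    have r3 : tree_size (r z i) <= 3 by rewrite /r; case: (bitval _ <= _).
    rewrite !map_drop.
    have := leq_drop_tlist (map enc_bool (s z)) i.
    by have := leq_drop_tlist (map enc_bool (t z)) i; lia.
  - move=> /ptime_snd/ptime_snd src.
    have ds := ptime_fst (ptime_fst src); have dt := ptime_snd (ptime_fst src).
    have rr := ptime_snd src; have ss := ptime_refl src.
    have nthE (u : seq bool) i :
        tfst (tlist (map enc_bool (drop i u))) = enc_bool (nth false u i).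
      by rewrite map_drop tfst_drop; elim: u i => [|b u IH] [|i] /=; rewrite ?IH.
    have bs := ptime_ext (ptime_fst ds) (fun y _ => nthE (s y.1) y.2).
    have bt := ptime_ext (ptime_fst dt) (fun y _ => nthE (t y.1) y.2).
    have ifs := ptime_if bs (ptime_andl (ptime_and bt (ptime_andl rr)))
      (ptime_andl (ptime_or bt rr)).
    apply: ptime_ext (ptime_pair (ptime_pair (ptime_snd ds) (ptime_snd dt)) ifs) _.
    move=> [z i] _ /=; rewrite /ac /r leq_bitval_takeS !map_drop !tsnd_drop.
    by case: nth.
move/ptime_snd/ptime_ext; apply=> z _.
by rewrite /= /r !take_oversize // size_cat !size_map ?leq_addr ?leq_addl.
Qed.

Lemma ptime_leq f g :
  ptime D sz a (fun z => enc_binary (f z)) ->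
  ptime D sz a (fun z => enc_binary (g z)) ->
  ptime D sz a (fun z => enc_bool (f z <= g z)).
Proof.
move=> af ag.
apply: ptime_ext (ptime_leq_bitval (s := fun z => bits (f z))
  (t := fun z => bits (g z)) _ _) _ => [|| z _]; last by rewrite !bits_val.
- by apply: ptime_ext af _ => z _; rewrite enc_binaryE.
- by apply: ptime_ext ag _ => z _; rewrite enc_binaryE.
Qed.

Lemma enc_unaryE n : enc_unary n = tlist (nseq n Leaf).
Proof. by elim: n => //= n ->. Qed.

Lemma ptime_ltn_unary m n :
  ptime D sz a (fun z => enc_unary (m z)) ->
  ptime D sz a (fun z => enc_unary (n z)) ->
  ptime D sz a (fun z => enc_bool (m z < n z)).
Proof.
move=> am an; have aa := ptime_refl am.
have am' : ptime D sz a (fun z => tlist (nseq (m z) Leaf)).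
  by apply: ptime_ext am _ => z _; rewrite enc_unaryE.
pose ac z i := tlist (drop i (nseq (n z) Leaf)).
have : ptime D sz a (fun z => ac z (size (nseq (m z) Leaf))).
  apply: (ptime_fold aa am').
  - by apply: ptime_ext an _ => z _; rewrite /ac drop0 enc_unaryE.
  - apply: (pbd_le (psize_fst (ptime_psize an) _)) => [y []//|[z i] _].
    by rewrite enc_unaryE leq_drop_tlist.
  - move=> src; apply: ptime_ext (ptime_snd (ptime_snd (ptime_snd src))) _.
    by move=> [z i] _; rewrite /ac /= tsnd_drop.
move/ptime_is_node/ptime_ext; apply=> z _; rewrite /ac size_nseq.
have := size_drop (m z) (nseq (n z) Leaf); rewrite size_nseq -subn_gt0 => <-.
by case: drop.
Qed.

(** Each round appends the accumulator to itself. The result may be exponential in the length of the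
    list, hence the separate bound on its value. This is how the threshold is produced from the bits
    of the denominator. *)
Lemma ptime_double_unary c L :
  ptime D sz a (fun z => tlist (L z)) ->
  pbd D sz (fun z => c * 2 ^ size (L z)) ->
  ptime D sz a (fun z => enc_unary (c * 2 ^ size (L z))).
Proof.
move=> aL bL; have aa := ptime_refl aL.
pose ac (z : Z) i := tlist (nseq (c * 2 ^ i) Leaf).
have : ptime D sz a (fun z => ac z (size (L z))).
  apply: (ptime_fold aa aL).
  - exact: (ptime_const (tlist (nseq (c * 2 ^ 0) Leaf)) aa).
  - have bL' := pbd_reindex (D' := fun y : Z * nat => D y.1 /\ y.2 < size (L y.1))
      (g := fst) bL (fun y => @proj1 _ _) (pbd_sz _ _).
    apply: (pbd_le (pbd_add (pbd_mul (pbd_const _ _ 2) bL') (pbd_const _ _ 1))).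
    move=> [z i] [/= _ lt_i].
    rewrite /ac size_tlist big_nseq iter_addn_0 addn1 ltnS.
    by rewrite leq_mul2l leq_mul2l leq_exp2l // (ltnW lt_i) orbT.
  - move=> src; have ac2 := ptime_snd (ptime_snd src).
    apply: ptime_ext (ptime_cat ac2 ac2) _ => -[z i] _; rewrite /ac /= cat_nseq.
    by rewrite /ncons -iterD -/(ncons _ _ _) expnS mulnCA mul2n addnn.
by move/ptime_ext; apply=> z _; rewrite enc_unaryE.
Qed.

End Compare.

(** * Selecting a candidate of maximal value *)

Section ArgMax.
Variables (T : eqType) (v : T -> nat).

Definition argmax (x : T) (s : seq T) : T :=
  foldl (fun b h => if v b <= v h then h else b) x s.

Lemma argmax_mem x s : argmax x s \in x :: s.
Proof.
elim: s x => [|h s IH] x /=; first exact: mem_head.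
have := IH (if v x <= v h then h else x); rewrite /argmax /= !inE.
by case: ifP => _ /orP[->|->]; rewrite ?orbT.
Qed.

Lemma leq_argmax x s h : h \in x :: s -> v h <= v (argmax x s).
Proof.
elim: s x h => [|g s IH] x h /=; first by rewrite inE => /eqP->.
have le0 := IH (if v x <= v g then g else x) _ (mem_head _ _).
rewrite !inE => /or3P[/eqP->|/eqP->|hs].
- by apply: leq_trans le0; case: ifP.
- by apply: leq_trans le0; case: (leqP (v x)) => // /ltnW.
- by apply: IH; rewrite inE hs orbT.
Qed.

End ArgMax.

Lemma leq_mem_tlist x s : x \in s -> tree_size x <= tree_size (tlist s).
Proof. by move=> /(nthP Leaf)[i _ <-]; apply: leq_nth_tlist. Qed.

(** The running maximum is always a member of the list, so the program for values need only be
    correct on listed candidates. [q z] is the context it reads beside the candidate. *)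
Lemma ptime_argmax (Z : Type) (T : eqType) (D : Z -> Prop) (sz : Z -> nat) a q
    (enc : T -> tree) (v : Z -> T -> nat) (x : Z -> T) (s : Z -> seq T) :
  ptime D sz a q ->
  ptime D sz a (fun z => tlist (map enc (x z :: s z))) ->
  ptime (fun y : Z * T => D y.1 /\ y.2 \in x y.1 :: s y.1) (fun y => sz y.1)
    (fun y => Node (q y.1) (enc y.2)) (fun y => enc_binary (v y.1 y.2)) ->
  ptime D sz a (fun z => enc (argmax (v z) (x z) (s z))).
Proof.
move=> aq axs pv.
pose ac z i := enc (argmax (v z) (x z) (take i (s z))).
have acin z i : argmax (v z) (x z) (take i (s z)) \in x z :: s z.
  have := argmax_mem (v z) (x z) (take i (s z)).
  by rewrite !inE => /orP[->//|/mem_take->]; rewrite orbT.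
have : ptime D sz a (fun z => ac z (size (map enc (s z)))).
  apply: (ptime_fold aq (ptime_snd axs)).
  - by apply: ptime_ext (ptime_fst axs) _ => z _; rewrite /ac take0.
  - apply: (pbd_le (psize_fst (ptime_psize axs) _)) => [y []//|[z i] _].
    exact: (leq_mem_tlist (map_f enc (acin z i))).
  - move=> src; have sq := ptime_fst src.
    have sh := ptime_fst (ptime_snd src); have sc := ptime_snd (ptime_snd src).
    have vc := ptime_reindex
      (D' := fun y : Z * nat => D y.1 /\ y.2 < size (map enc (s y.1)))
      (g := fun y => (y.1, argmax (v y.1) (x y.1) (take y.2 (s y.1))))
      pv (fun y Dy => conj (proj1 Dy) (acin _ _)) (pbd_sz _ _).
    have vh := ptime_reindex
      (D' := fun y : Z * nat => D y.1 /\ y.2 < size (map enc (s y.1)))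
      (g := fun y => (y.1, nth (x y.1) (s y.1) y.2)) (sz' := fun y => sz y.1)
      pv _ (pbd_sz _ _).
    have sc' := ptime_seq (ptime_pair sq sc) vc.
    have {vh} sh' := ptime_seq (ptime_ext (ptime_pair sq sh) _) (vh _).
    have le := ptime_leq sc' (sh' _ _).
    apply: ptime_ext (ptime_if (le _ _) (ptime_andl sh) (ptime_andl sc)) _.
    + by move=> [z i] [/= _]; rewrite size_map => lt_i; rewrite (nth_map (x z)).
    + move=> [z i] [/= Dz]; rewrite size_map => lt_i; split=> //.
      by rewrite inE mem_nth ?orbT.
    + move=> [z i] [/= _]; rewrite size_map => lt_i.
      rewrite /ac (take_nth (x z) lt_i) /argmax foldl_rcons (nth_map (x z)) //.
      by case: ifP.
by move/ptime_ext; apply=> z _; rewrite /ac size_map take_size.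
Qed.

Lemma leq_size_tlist_bound c s :
  all (fun x => tree_size x <= c) s -> tree_size (tlist s) <= size s * c.+1 + 1.
Proof. by elim: s => //= x s IH /andP[xc /IH]; lia. Qed.

(** * Candidate solutions *)

Definition window (T : Type) (w : seq T) (l : seq T) (j : nat) : seq T :=
  take j l ++ w ++ drop (j + size w) l.

(** The reversal is the order produced by a loop that prepends its results. *)
Definition windows (T : Type) (w : seq T) (l : seq T) : seq (seq T) :=
  rev [seq window w l j | j <- iota 0 (size l - size w).+1].

Lemma size_rev_tlist s : tree_size (tlist (rev s)) = tree_size (tlist s).
Proof. by have := size_catrev_tlist s [::]; rewrite catrevE cats0 /=; lia. Qed.

Lemma size_cat_tlist s t :
  (tree_size (tlist (s ++ t))).+1 = tree_size (tlist s) + tree_size (tlist t).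
Proof. by rewrite -[s in LHS]revK -catrevE size_catrev_tlist size_rev_tlist. Qed.

Lemma ptime_windows (Z : Type) (D : Z -> Prop) (sz : Z -> nat) a
    (w : seq tree) (L : Z -> seq tree) :
  0 < size w -> (forall z, D z -> size w <= size (L z)) ->
  ptime D sz a (fun z => tlist (L z)) ->
  ptime D sz a (fun z => tlist (map (enc_seq id) (windows w (L z)))).
Proof.
move=> w_gt0 le_w aL; have aa := ptime_refl aL.
(* A zipper: the reversed prefix and the suffix at position i, with the windows found so far.
   Replacing the first [size w] elements of the suffix by [w] and reversing the prefix back onto it
   gives the window at i. *)
pose ac z i := Node (Node (tlist (rev (take i (L z)))) (tlist (drop i (L z))))
  (tlist [seq tlist (window w (L z) j) | j <- rev (iota 0 i)]).
(* There are [size (L z) - size w + 1] positions. Dropping one element fewer than [size w] leaves a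
   list of exactly this length to drive the loop. *)
pose Lw z := drop (size w).-1 (L z).
have : ptime D sz a (fun z => ac z (size (Lw z))); last first.
  move/ptime_snd/ptime_ext; apply=> z Dz /=; congr tlist.
  rewrite /windows -map_rev -map_comp size_drop.
  suff -> : size (L z) - (size w).-1 = (size (L z) - size w).+1 by [].
  by have := le_w z Dz; lia.
apply: (ptime_fold aa (ptime_drop _ aL)).
- have := ptime_pair (ptime_pair (ptime_const Leaf aa) aL) (ptime_const Leaf aa).
  by move/ptime_ext; apply=> z _; rewrite /ac take0 drop0.
- have bL := psize_fst (D' := fun y : Z * nat => D y.1 /\ y.2 < size (Lw y.1))
    (ptime_psize aL) (fun y => @proj1 _ _).
  pose c := tree_size (tlist w); pose N z := tree_size (tlist (L z)).
  apply: (pbd_le (pbd_add (pbd_add (pbd_add bL bL) (pbd_const _ _ 3))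
    (pbd_mul bL (pbd_add (pbd_add bL bL) (pbd_const _ _ c.+1))))) => -[z i] [/=].
  move=> Dz lt_i; rewrite size_rev_tlist.
  have := leq_take_tlist (L z) i; have := leq_drop_tlist (L z) i.
  have := @leq_size_tlist_bound (N z + N z + c)
    [seq tlist (window w (L z) j) | j <- rev (iota 0 i)].
  rewrite size_map size_rev size_iota => bout.
  have {}bout := bout _; move: lt_i; rewrite size_drop => lt_i.
  have : i <= N z by have := leq_size_tlist (L z); rewrite /N; lia.
  move/leq_mul => /(_ _ _ (leqnn (N z + N z + c).+1)); rewrite /N.
  suff /bout : all (fun x => tree_size x <= N z + N z + c)
      [seq tlist (window w (L z) j)  | j <- rev (iota 0 i)] by rewrite /N; lia.
  apply/allP => _ /mapP[j _ ->]; rewrite /window.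
  have := size_cat_tlist (take j (L z)) (w ++ drop (j + size w) (L z)).
  have := size_cat_tlist w (drop (j + size w) (L z)).
  have := leq_take_tlist (L z) j; have := leq_drop_tlist (L z) (j + size w).
  by rewrite -/c /N; lia.
- move=> src; have acc := ptime_snd (ptime_snd src).
  have tk := ptime_fst (ptime_fst acc); have dr := ptime_snd (ptime_fst acc).
  have out := ptime_snd acc.
  have cand := ptime_catrev tk (ptime_cat_const w (ptime_drop (size w) dr)).
  apply: ptime_ext (ptime_pair (ptime_pair (ptime_pair (ptime_fst dr) tk)
    (ptime_snd dr)) (ptime_pair cand out)) _.
  move=> [z i] [/= Dz lt_i].
  have lt_iL : i < size (L z) by rewrite size_drop in lt_i; lia.
  rewrite /ac (take_nth Leaf lt_iL) rev_rcons tsnd_drop -addn1 iotaD rev_cat /=.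
  by rewrite tfst_drop add0n /window catrevE revK drop_drop [i + size w]addnC.
Qed.

(** Written as a left fold so that it is literally what the loop computes. *)
Definition extend (T : Type) (s : seq T) (u : seq (seq T)) : seq (seq T) :=
  foldl (fun v l => [seq b :: l | b <- s] ++ v) [::] u.

Fixpoint words (T : Type) (s : seq T) (n : nat) : seq (seq T) :=
  if n is m.+1 then extend s (words s m) else [:: [::]].

Lemma mem_extend (T : eqType) (s : seq T) u l :
  (l \in extend s u) = has (fun k => l \in [seq b :: k | b <- s]) u.
Proof.
rewrite /extend -[RHS](orFb) -(in_nil l).
elim: u [::] => [|k u IHu] v /=; first by rewrite orbF.
by rewrite IHu mem_cat orbA; congr (_ || _); rewrite orbC.
Qed.

Lemma size_extend (T : Type) (s : seq T) u : size (extend s u) = size u * size s.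
Proof.
rewrite /extend -[RHS]addn0 -[X in _ + X]/(size (Nil (seq T))).
by elim: u [::] => //= k u IHu v; rewrite IHu size_cat size_map; lia.
Qed.

Lemma mem_words (T : eqType) (s : seq T) n l :
  (l \in words s n) = (size l == n) && all (mem s) l.
Proof.
elim: n l => [|n IH] l; first by rewrite /= inE; case: l.
rewrite /= mem_extend; apply/hasP/idP => [[k]|].
  by rewrite IH => /andP[/eqP sk ak] /mapP[b bs ->] /=; rewrite sk eqxx bs ak.
case: l => //= b l /andP[sl /andP[bs al]]; exists l; last exact: map_f.
by rewrite IH -eqSS sl.
Qed.

Lemma size_words (T : Type) (s : seq T) n : size (words s n) = size s ^ n.
Proof. by elim: n => //= n IH; rewrite size_extend IH expnSr. Qed.

Lemma map_words (T U : Type) (f : T -> U) s n :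
  words (map f s) n = map (map f) (words s n).
Proof.
elim: n => //= n ->; rewrite /extend.
rewrite -[Nil (seq U)]/(map (map f) [::]).
elim: (words s n) [::] => //= l u IH v; rewrite -IH map_cat -!map_comp.
by congr (foldl _ (_ ++ _) _); apply: eq_map => b.
Qed.

Lemma map_window (T U : Type) (f : T -> U) w l j :
  window (map f w) (map f l) j = map f (window w l j).
Proof. by rewrite /window !map_cat map_take map_drop size_map. Qed.

Lemma map_windows (T U : Type) (f : T -> U) w l :
  windows (map f w) (map f l) = map (map f) (windows w l).
Proof.
rewrite /windows map_rev -map_comp !size_map; congr rev.
by apply: eq_map => j; rewrite map_window.
Qed.

Lemma ptime_cons_each (Z : Type) (D : Z -> Prop) (sz : Z -> nat) a s l S :
  ptime D sz a l -> ptime D sz a (fun z => tlist (S z)) ->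
  ptime D sz a (fun z => tlist ([seq Node b (l z) | b <- s] ++ S z)).
Proof.
move=> al aS; elim: s => //= b s IH.
exact: ptime_pair (ptime_pair (ptime_const b (ptime_refl al)) al) IH.
Qed.

Section Words.
Variables (Z : Type) (D : Z -> Prop) (sz : Z -> nat) (a : Z -> tree).

Lemma ptime_extend s S :
  ptime D sz a (fun z => tlist (map (enc_seq id) (S z))) ->
  ptime D sz a (fun z => tlist (map (enc_seq id) (extend s (S z)))).
Proof.
move=> aS; have aa := ptime_refl aS.
pose ac z i := tlist (map (enc_seq id) (extend s (take i (S z)))).
have : ptime D sz a (fun z => ac z (size (map (enc_seq id) (S z)))).
  apply: (ptime_fold aa aS).
  - by apply: ptime_ext (ptime_const Leaf aa) _ => z _; rewrite /ac take0.
  - pose c := tree_size (tlist s).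
    have bS := psize_fst
      (D' := fun y : Z * nat => D y.1 /\ y.2 < size (map (enc_seq id) (S y.1)))
      (ptime_psize aS) (fun y => @proj1 _ _).
    apply: (pbd_le (pbd_add (pbd_mul (pbd_mul bS (pbd_const _ _ (size s)))
      (pbd_add bS (pbd_const _ _ c.+2))) (pbd_const _ _ 1))) => -[z i] [/= _ lt_i].
    rewrite /ac; set N := tree_size (tlist (map _ (S z))).
    apply: leq_trans (leq_size_tlist_bound (c := N + c.+1) _) _.
      apply/allP => _ /mapP[l + ->]; rewrite mem_extend => /hasP[k /mem_take kS].
      move=> /mapP[b bs ->] /=; have := leq_mem_tlist bs.
      by have := leq_mem_tlist (map_f (enc_seq id) kS); rewrite -/N -/c; lia.
    rewrite size_map size_extend leq_add2r -(addnS N c.+1) leq_mul // leq_mul //.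
    have := leq_size_tlist (map (enc_seq id) (S z)); rewrite -/N size_map.
    by have := size_take_min i (S z); lia.
  - move=> src; have ss := ptime_snd src.
    apply: ptime_ext (ptime_cons_each s
      (S := fun y => map (enc_seq id) (extend s (take y.2 (S y.1))))
      (ptime_fst ss) (ptime_snd ss)) _.
    move=> [z i] [/= _]; rewrite size_map => lt_i.
    rewrite /ac (take_nth [::] lt_i) /extend foldl_rcons map_cat.
    by rewrite (nth_map [::]) // -map_comp.
by move/ptime_ext; apply=> z _; rewrite /ac size_map take_size.
Qed.

Lemma ptime_filter_sub s S :
  ptime D sz a (fun z => tlist (map (enc_seq id) (S z))) ->
  ptime D sz a
    (fun z => tlist (map (enc_seq id) (rev [seq l <- S z | all (mem l) s]))).
Proof.
move=> aS; have aa := ptime_refl aS.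
pose P (l : seq tree) := all (mem l) s.
pose ac z i := tlist (map (enc_seq id) (rev (filter P (take i (S z))))).
have : ptime D sz a (fun z => ac z (size (map (enc_seq id) (S z)))).
  apply: (ptime_fold aa aS).
  - by apply: ptime_ext (ptime_const Leaf aa) _ => z _; rewrite /ac take0.
  - apply: (pbd_le (psize_fst (ptime_psize aS) _)) => [y []//|[z i] [/= _ _]].
    rewrite /ac map_rev size_rev_tlist.
    apply: leq_trans (leq_take_tlist _ i); rewrite -map_take.
    by elim: (take i (S z)) => //= l u IH; case: ifP => _ /=; lia.
  - move=> src; have ss := ptime_snd src; have h := ptime_fst ss.
    have acs := ptime_snd ss.
    have hE (y : Z * nat) : D y.1 /\ y.2 < size (map (enc_seq id) (S y.1)) ->
        nth Leaf (map (enc_seq id) (S y.1)) y.2 = tlist (nth [::] (S y.1) y.2).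
      by case=> _; rewrite size_map => lt_i; rewrite (nth_map [::]).
    have h' := ptime_ext h hE.
    apply: ptime_ext (ptime_if (ptime_sub_const s h')
      (ptime_andl (ptime_pair h' acs)) (ptime_andl acs)) _.
    move=> [z i] [/= _]; rewrite size_map => lt_i.
    rewrite /ac (take_nth [::] lt_i) filter_rcons /=.
    by rewrite -/(P _); case: (P _); rewrite ?rev_rcons.
by move/ptime_ext; apply=> z _; rewrite /ac size_map take_size.
Qed.

End Words.

(** The number of words is exponential in [n z], so a bound on it is assumed. It will be available
    below the threshold, where [sz] includes such an exponential. The successor keeps the base
    positive, hence the power monotone in the exponent. *)
Lemma ptime_words (Z : Type) (D : Z -> Prop) (sz : Z -> nat) (a : Z -> tree) s n :
  ptime D sz a (fun z => enc_unary (n z)) ->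
  pbd D sz (fun z => (size s).+1 ^ n z) ->
  ptime D sz a (fun z => tlist (map (enc_seq id) (words s (n z)))).
Proof.
move=> an bn; have aa := ptime_refl an.
have {}an : ptime D sz a (fun z => tlist (nseq (n z) Leaf)).
  by apply: ptime_ext an _ => z _; rewrite enc_unaryE.
pose ac (z : Z) i := tlist (map (enc_seq id) (words s i)).
have : ptime D sz a (fun z => ac z (size (nseq (n z) Leaf))).
  apply: (ptime_fold aa an).
  - exact: ptime_const (tlist (map (enc_seq id) (words s 0))) aa.
  - pose c := tree_size (tlist s).
    pose D' (y : Z * nat) := D y.1 /\ y.2 < size (nseq (n y.1) Leaf).
    have bL := psize_fst (D' := D') (ptime_psize an) (fun y => @proj1 _ _).
    have bE := pbd_reindex (D' := D') (g := fst) bn (fun y => @proj1 _ _)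
      (pbd_sz _ _).
    apply: (pbd_le (pbd_add (pbd_mul bE (pbd_add (pbd_mul bL (pbd_const _ _ c.+1))
      (pbd_const _ _ 2))) (pbd_const _ _ 1))) => -[z i] [/= _].
    rewrite size_nseq => lt_i; rewrite /ac.
    set N := tree_size (tlist (nseq _ _)).
    have leN : i <= N.
      by have := leq_size_tlist (nseq (n z) Leaf); rewrite size_nseq -/N; lia.
    apply: leq_trans (leq_size_tlist_bound (c := N * c.+1 + 1) _) _.
      apply/allP => _ /mapP[l + ->]; rewrite mem_words => /andP[/eqP sl /allP al].
      apply: leq_trans (leq_size_tlist_bound (c := c) _) _.
        by apply/allP => x /al /leq_mem_tlist.
      by rewrite sl leq_add2r leq_mul2r leN orbT.
    rewrite size_map size_words leq_add2r leq_mul ?addn2 ?addn1 //.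
    apply: (@leq_trans ((size s).+1 ^ i)); last by rewrite leq_pexp2l // ltnW.
    by case: (i) => // j; rewrite leq_exp2r.
  - by move=> src; apply: ptime_extend (ptime_snd (ptime_snd src)).
by move/ptime_ext; apply=> z _; rewrite /ac size_nseq.
Qed.

(** * Encodings of maps and membership in NPO *)

Lemma enc_seqE (T : Type) (enc : T -> tree) s :
  enc_seq enc s = tlist (map enc s).
Proof. by elim: s => //= x s ->. Qed.

Lemma enc_unary_inj : injective enc_unary.
Proof. by elim=> [|m IH] [|n] //= [/IH->]. Qed.

Lemma tlist_inj : injective (enc_seq id).
Proof. by elim=> [|x s IH] [|y t] //= [-> /IH->]. Qed.

Fixpoint subtrees (x : tree) : seq tree :=
  if x is Node a b then a :: subtrees b else [::].

(** Every tree encodes a list of trees, so list programs apply to arbitrary input without a syntax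
    check. *)
Lemma subtreesK x : tlist (subtrees x) = x.
Proof. by elim: x => //= a _ b ->. Qed.

Section Maps.
Variable B : finType.

Definition enc_elt (b : B) : tree := enc_unary (enum_rank b).

Lemma enc_elt_inj : injective enc_elt.
Proof. by move=> b c /enc_unary_inj/val_inj/enum_rank_inj. Qed.

Definition graph (n : nat) (h : {ffun 'I_n -> B}) : seq B :=
  [seq h i | i <- enum 'I_n].

Lemma size_graph n (h : {ffun 'I_n -> B}) : size (graph h) = n.
Proof. by rewrite size_map size_enum_ord. Qed.

Lemma nth_graph b0 n (h : {ffun 'I_n -> B}) (i : 'I_n) : nth b0 (graph h) i = h i.
Proof. by rewrite (nth_map i) ?size_enum_ord // nth_ord_enum. Qed.

Lemma mem_graph n (h : {ffun 'I_n -> B}) b :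
  reflect (exists i, h i = b) (b \in graph h).
Proof.
apply: (iffP mapP) => [[i _ ->]|[i <-]]; first by exists i.
by exists i; rewrite ?mem_enum.
Qed.

Lemma enc_mapE n (h : {ffun 'I_n -> B}) :
  enc_map h = tlist (map enc_elt (graph h)).
Proof. by rewrite /enc_map enc_seqE /graph -map_comp. Qed.

Lemma surjectiveE n (h : {ffun 'I_n -> B}) :
  surjective h = all (mem (graph h)) (enum B).
Proof.
apply/forallP/allP => [sh b _|sh b].
  by have /existsP[i /eqP hi] := sh b; apply/mem_graph; exists i.
have /mem_graph[i hi] := sh b (mem_enum _ _).
by apply/existsP; exists i; apply/eqP.
Qed.

Variable b0 : B.

Definition of_graph (n : nat) (l : seq B) : {ffun 'I_n -> B} :=
  [ffun i : 'I_n => nth b0 l i].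

Lemma graphK n (h : {ffun 'I_n -> B}) : of_graph n (graph h) = h.
Proof. by apply/ffunP => i; rewrite ffunE nth_graph. Qed.

Lemma of_graphK n l : size l = n -> graph (of_graph n l) = l.
Proof.
move=> sl; apply: (@eq_from_nth _ b0); rewrite size_graph // => i lt_in.
by rewrite (nth_graph b0 _ (Ordinal lt_in)) ffunE.
Qed.

End Maps.

Lemma ptime_iter_snd (Z : Type) (D : Z -> Prop) sz a b c :
  ptime D sz a b -> ptime D sz a (fun z => iter c tsnd (b z)).
Proof. by move=> ab; elim: c => //= c; apply: ptime_snd. Qed.

Lemma iter_tsnd_unary c n : iter c tsnd (enc_unary n) = enc_unary (n - c).
Proof.
elim: c => [|c IH]; first by rewrite subn0.
by rewrite iterS IH subnS; case: (n - c).
Qed.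

(** Only the two recognizers change: each is followed by a further test, of the domain size for
    instances and of surjectivity for solutions. *)
Lemma NPO_surjective (sigma : signature) (B : structure sigma) :
  NPO (Max_CSP B) -> NPO (Max_Sur_CSP B).
Proof.
case=> inj_i inj_s [ki size_i] [pi [li inst_i]] [ks size_s] [ps [ls sol_s]]
  [pv [lv val_v]].
split.
- by move=> I J /inj_i; apply: val_inj.
- by move=> I s t /inj_s; apply: val_inj.
- by exists ki => I; apply: (size_i (val I)).
(* The answer bit is only known to exist for each input. Taking it into the index makes the given
   recognizer a [ptime] program. *)
- pose D (z : tree * bool) := runs_within pi li (tree_size z.1) z.1 (enc_bool z.2).
  have run_pi : ptime D (fun z => tree_size z.1) fst (fun z => enc_bool z.2).
    by apply/ptime_runs; exists pi, li.
  (* On an encoded listing this removes #|B| from the domain size plus one. The extra one turns the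
     strict test for a nonzero remainder into #|B| <= n. *)
  pose t d :=
    if iter #|B| tsnd (Node Leaf (tfst d)) is Node _ _ then true else false.
  have aa := ptime_refl run_pi.
  have test := ptime_is_node
    (ptime_iter_snd #|B| (ptime_pair (ptime_const Leaf aa) (ptime_fst aa))).
  have /ptime_runs[p [k pk]] := ptime_and run_pi (ptime_andl test).
  have tE (L : listing sigma) : t (enc_listing L) = (#|B| <= ldom L).
    rewrite /t -[Node _ _]/(enc_unary (ldom L).+1) iter_tsnd_unary -ltnS -subn_gt0.
    by case: (_ - _).
  exists p, k => d; have [b [run_b b_i]] := inst_i d.
  exists (b && t d); split; first exact: (pk (d, b) run_b).
  split=> [/andP[/b_i[L <-]]|[[L leL] dE]].
    rewrite tE -[ldom L]card_ord => leL.
    by exists (exist (fun L => is_true (#|B| <= #|struct_of L|)) L leL).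
  have -> : b by apply/b_i; exists L.
  by rewrite -dE /= tE -[ldom L]card_ord.
- by exists ks => I s; apply: (size_s (val I)).
- pose D (z : inst (Max_Sur_CSP B) * tree * bool) := runs_within ps ls
    (isize z.1.1 + tree_size z.1.2) (Node (enc_inst z.1.1) z.1.2) (enc_bool z.2).
  have run_ps : ptime D (fun z => isize z.1.1 + tree_size z.1.2)
      (fun z => Node (enc_inst z.1.1) z.1.2) (fun z => enc_bool z.2).
    by apply/ptime_runs; exists ps, ls.
  have dd : ptime D (fun z => isize z.1.1 + tree_size z.1.2)
      (fun z => Node (enc_inst z.1.1) z.1.2) (fun z => tlist (subtrees z.1.2)).
    by apply: ptime_ext (ptime_snd (ptime_refl run_ps)) _ => z; rewrite subtreesK.
  have /ptime_runs[p [k pk]] := ptime_and run_ps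
    (ptime_andl (ptime_sub_const (map (@enc_elt B) (enum B)) dd)).
  exists p, k => I d; have [b [run_b b_s]] := sol_s (val I) d.
  exists (b && all (mem (subtrees d)) (map (@enc_elt B) (enum B))).
  split; first exact: (pk (I, d, b) run_b).
  have tE (h : {ffun struct_of (val I) -> B}) :
      all (mem (subtrees (enc_map h))) (map (@enc_elt B) (enum B)) = surjective h.
    rewrite surjectiveE all_map enc_mapE.
    rewrite (tlist_inj (subtreesK (tlist (map (@enc_elt B) (graph h))))).
    by apply: eq_all => c; rewrite /= mem_map //; apply: enc_elt_inj.
  split=> [/andP[/b_s[h <-]]|[[h sh] dE]].
    by rewrite tE => sh; exists (exist _ h sh).
  have -> : b by apply/b_s; exists h.
  by rewrite -dE /= tE.
- by exists pv, lv => I s; apply: (val_v (val I) (val s)).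
Qed.

(** * Hardness *)

Lemma eq_enc_seq (T : Type) (f g : T -> tree) s :
  f =1 g -> enc_seq f s = enc_seq g s.
Proof. by move=> fg; elim: s => //= x s ->; rewrite fg. Qed.

Lemma enc_seq_map (T U : Type) (f : T -> U) enc s :
  enc_seq enc (map f s) = enc_seq (fun x => enc (f x)) s.
Proof. by elim: s => //= x s ->. Qed.

Section Padding.
Variables (sigma : signature) (B : structure sigma).
Let m := #|B|.

Definition pad_rel (L : listing sigma) (i : 'I_(nsym sigma)) :
    seq ((arity i).-tuple 'I_(ldom L + m)) :=
  map (map_tuple (lshift m)) (lrel L i).

Lemma map_lshift_inj n k : injective (@map_tuple k _ _ (@lshift n m)).
Proof.
move=> t u /(congr1 val) /= /inj_map eq_tu; apply: val_inj.
exact/eq_tu/lshift_inj.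
Qed.

Lemma pad_uniq (L : listing sigma) : [forall i, uniq (pad_rel L i)].
Proof.
apply/forallP => i; rewrite map_inj_uniq; last exact: map_lshift_inj.
exact: (forallP (lrel_uniq L) i).
Qed.

Definition pad (L : listing sigma) : listing sigma := Listing (pad_uniq L).

(** The new elements come last, so the old ones keep their codes and only the domain size changes in
    the encoding. *)
Lemma enc_pad (L : listing sigma) :
  enc_listing (pad L) = Node (enc_unary (ldom L + m)) (tsnd (enc_listing L)).
Proof.
congr Node; apply: eq_enc_seq => i; rewrite !enc_seq_map.
by apply: eq_enc_seq => t; rewrite enc_seq_map.
Qed.

Lemma pad_large (L : listing sigma) : #|B| <= #|struct_of (pad L)|.
Proof. by rewrite card_ord leq_addl. Qed.

Definition pad_inst (L : inst (Max_CSP B)) : inst (Max_Sur_CSP B) :=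
  exist (fun L => is_true (#|B| <= #|struct_of L|)) (pad L) (pad_large L).

Definition restr (L : listing sigma) (h : {ffun struct_of (pad L) -> B}) :
  {ffun struct_of L -> B} := [ffun i => h (lshift m i)].

Definition extension (L : listing sigma) (h : {ffun struct_of L -> B}) :
    {ffun struct_of (pad L) -> B} :=
  [ffun i : 'I_(ldom L + m) =>
     match split i with inl j => h j | inr k => enum_val k end].

Lemma extensionK L (h : {ffun struct_of L -> B}) : restr (extension h) = h.
Proof.
apply/ffunP => i; rewrite !ffunE.
by case: splitP => [j /= /val_inj->|k /=] //; have := ltn_ord i; lia.
Qed.

Lemma extension_surjective L (h : {ffun struct_of L -> B}) :
  surjective (extension h).
Proof.
apply/forallP => b; apply/existsP; exists (rshift (ldom L) (enum_rank b)).
rewrite ffunE; case: splitP => [j /=|k /= /addnI/val_inj<-].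
  by have := ltn_ord j; lia.
by rewrite enum_rankK.
Qed.

Lemma csp_value_restr L (h : {ffun struct_of (pad L) -> B}) :
  csp_value (restr h) = csp_value h.
Proof.
apply: eq_bigr => i _ /=.
rewrite -(card_imset _ (@map_lshift_inj (ldom L) (arity i))).
have mapE (t : (arity i).-tuple 'I_(ldom L)) :
    map_tuple h (map_tuple (lshift m) t) = map_tuple (restr h) t.
  apply: val_inj => /=; rewrite -map_comp; apply: eq_map => j /=.
  by rewrite ffunE.
apply: eq_card => u; rewrite !inE; apply/imsetP/andP => [[t + ->]|[/mapP[t tL ->]]].
  by rewrite !inE mapE => /andP[tL ht]; rewrite map_f.
by rewrite mapE => ht; exists t; rewrite // !inE tL.
Qed.

(** Restriction and extension preserve values, the isolated elements lying in no tuple. Hence both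
    problems have the same optimum. *)
Lemma approximate_restr r L (s : sol (pad_inst L)) :
  approximate r s -> @approximate (Max_CSP B) r L (restr (val s)).
Proof.
case=> v [[s' s'v] le_v] rv; exists v; last by rewrite /= csp_value_restr.
split; first by exists (restr (val s')); rewrite /= csp_value_restr.
move=> h; have := le_v (exist _ (extension h) (extension_surjective h)).
by rewrite /= -csp_value_restr extensionK.
Qed.

(** Stated by dropping from the reversed list because [m] is a constant of the program, whereas
    taking [ldom L] elements would need a counter. *)
Lemma graph_restr L (h : {ffun struct_of (pad L) -> B}) :
  graph (restr h) = rev (drop m (rev (graph (h : {ffun 'I_(ldom L + m) -> B})))).
Proof.
rewrite drop_rev revK size_graph addnK -map_take.
have <- : map (lshift m) (enum 'I_(ldom L)) = take (ldom L) (enum 'I_(ldom L + m)).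
  apply: (inj_map val_inj); rewrite map_take -map_comp (eq_map (g := val)) //.
  by rewrite !val_enum_ord take_iota (minn_idPl (leq_addr _ _)).
by rewrite -map_comp; apply: eq_map => i; rewrite ffunE.
Qed.

End Padding.

(** Padding changes neither values nor optimum, so [alpha] and [e] are kept. [NPO Q] bounds the
    encoding of the instance, which the new program has to carry along while it restricts the
    solution. *)
Lemma AP_reducible_surjective (Q : problem) (sigma : signature)
    (B : structure sigma) :
  NPO Q -> AP_reducible Q (Max_CSP B) -> AP_reducible Q (Max_Sur_CSP B).
Proof.
move=> npoQ [F [G [alpha [e [polyF polyG e0 apx]]]]].
have runF : ptime (fun=> True) (@isize Q) (@enc_inst Q) (fun I => enc_inst (F I)).
  by apply/ptime_runs; have [p [k pk]] := polyF; exists p, k.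
exists (fun I => pad_inst (F I)), (fun I s => G I (restr (val s))), alpha, e.
split=> //.
- have runF' : ptime (fun=> True) (@isize Q) (@enc_inst Q)
      (fun I => enc_inst (pad_inst (F I))).
    have := ptime_pair (ptime_cat_const (nseq #|B| Leaf)
      (M := fun I => nseq (ldom (F I)) Leaf)
      (ptime_ext (ptime_fst runF) (fun I _ => enc_unaryE _))) (ptime_snd runF).
    move/ptime_ext; apply=> I _; rewrite [RHS]enc_pad addnC enc_unaryE nseqD.
    by [].
  have /ptime_runs[p [k pk]] := runF'.
  by exists p, k => I; apply: pk.
- pose Z := {I : inst Q & sol (pad_inst (F I))}.
  pose sz (z : Z) := isize (projT1 z) + tree_size (enc_sol (projT2 z)).
  pose a (z : Z) := Node (enc_inst (projT1 z)) (enc_sol (projT2 z)).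
  pose h (z : Z) := restr (val (projT2 z)).
  have bs : pbd (fun=> True) sz (fun z => isize (projT1 z)).
    by apply: (pbd_le (pbd_sz _ sz)) => z _; apply: leq_addr.
  have aa : ptime (fun=> True) sz a a.
    apply: ptime_id; have [k size_k] := npo_isize npoQ.
    apply: (pbd_le (pbd_add (pbd_pbound k bs)
      (pbd_add (pbd_sz _ sz) (pbd_const _ _ 1)))).
    by move=> z _; have [] := size_k (projT1 z); rewrite /sz /=; lia.
  have as' : ptime (fun=> True) sz a (fun z => enc_map (h z)).
    have aL : ptime (fun=> True) sz a (fun z => tlist (map (@enc_elt B)
        (graph (val (projT2 z) : {ffun 'I_(ldom (F (projT1 z)) + #|B|) -> B})))).
      by apply: ptime_ext (ptime_snd aa) _ => z _; rewrite -enc_mapE.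
    apply: ptime_ext (ptime_rev (ptime_drop #|B| (ptime_rev aL))) _ => z _.
    by rewrite enc_mapE graph_restr map_rev map_drop map_rev.
  pose Y := {I : inst Q & sol (F I)}.
  pose szY (y : Y) := isize (projT1 y) + tree_size (enc_sol (projT2 y)).
  have runG : ptime (fun=> True) szY
      (fun y => Node (enc_inst (projT1 y)) (enc_sol (projT2 y)))
      (fun y => enc_sol (G (projT1 y) (projT2 y))).
    apply/ptime_runs; have [p [k pk]] := polyG.
    by exists p, k => y _; apply: pk.
  have runG' := ptime_reindex (g := fun z : Z => existT _ (projT1 z) (h z) : Y)
    (D' := fun=> True) (sz' := sz) runG (fun _ => id)
    (pbd_add bs (ptime_psize as')).
  have /ptime_runs[p [k pk]] := ptime_seq (ptime_pair (ptime_fst aa) as') runG'.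
  by exists p, k => I s; apply: (pk (existT _ I s)).
- by move=> I s r r1 /approximate_restr; apply: apx.
Qed.

(** * Approximation *)

Lemma csp_valueE (sigma : signature) (A B : structure sigma) (h : {ffun A -> B}) :
  csp_value h =
  \sum_i \sum_(t in rel_of A i) (map_tuple h t \in rel_of B i).
Proof.
apply: eq_bigr => i _; rewrite -sum1_card big_mkcond [RHS]big_mkcond.
by apply: eq_bigr => t _; rewrite !inE; case: (t \in _); case: (_ \in _).
Qed.

(** The windows covering x start at some w with x - m < w <= x. The difference of minima used in the
    proof counts those below W exactly, in a form suited to induction on W. *)
Lemma count_windows (m x W : nat) : \sum_(w < W) (w <= x < w + m) <= m.
Proof.
suff -> : \sum_(w < W) (w <= x < w + m) = minn W x.+1 - minn W (x.+1 - m) by lia.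
elim: W => [|W IH]; first by rewrite big_ord0 !min0n.
rewrite big_ord_recr /= IH.
case: (leqP W x) => /=; case: (ltnP x (W + m)) => /=; lia.
Qed.

Lemma size_window (T : Type) (s l : seq T) j :
  j + size s <= size l -> size (window s l j) = size l.
Proof.
by move=> le; rewrite /window !size_cat size_takel ?size_drop; lia.
Qed.

Section Averaging.
Variables (sigma : signature) (B : structure sigma) (b0 : B).
Let m := #|B|.
Let K := \sum_(i < nsym sigma) arity i.

Definition window_map (L : listing sigma) (h : {ffun struct_of L -> B}) (w : nat) :
  {ffun struct_of L -> B} := of_graph b0 (ldom L) (window (enum B) (graph h) w).

Lemma window_map_out L (h : {ffun struct_of L -> B}) w (i : 'I_(ldom L)) :
  w + m <= ldom L -> ~~ (w <= i < w + m) -> window_map h w i = h i.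
Proof.
move=> le_w out; rewrite ffunE -[h i](nth_graph b0) /window.
have tk : size (take w (graph h)) = w by rewrite size_takel // size_graph; lia.
rewrite nth_cat tk; case: ltnP => [lt_i|le_i]; first by rewrite nth_take.
rewrite nth_cat -cardE; case: ltnP => [lt_i|le_i'].
  by move: out; rewrite le_i -ltn_subLR /m /= ?lt_i.
by rewrite nth_drop; congr nth; lia.
Qed.

(** Double counting, tuple by tuple: if [h] satisfies [t], each window either leaves [t] satisfied
    or covers one of its coordinates. Each coordinate is covered at most [m] times, and the arity of
    [t] is at most [K]. *)
Lemma window_map_average (L : listing sigma) (h : {ffun struct_of L -> B}) :
  m <= ldom L -> forall W, W = (ldom L - m).+1 ->
  W * csp_value h <= \sum_(w < W) csp_value (window_map h w) + m * K * csp_value h.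
Proof.
move=> le_m W WE; rewrite !csp_valueE.
under [X in _ <= X + _]eq_bigr do rewrite csp_valueE.
rewrite exchange_big !big_distrr -big_split /=; apply: leq_sum => i _.
rewrite exchange_big !big_distrr -big_split /=; apply: leq_sum => t tL.
case ht: (map_tuple h t \in _); last by rewrite !muln0.
rewrite !muln1; apply: (@leq_trans (\sum_(w < W)
    ((map_tuple (window_map h w) t \in rel_of B i) +
     \sum_(j < arity i) (w <= tnth t j < w + m)))).
  rewrite -[X in X <= _]card_ord -sum1_card; apply: leq_sum => w _.
  have [/existsP[j tj]|] := boolP [exists j, w <= tnth t j < w + m].
    by rewrite (bigD1 j) //= tj; lia.
  rewrite negb_exists => /forallP out.
  suff -> : map_tuple (window_map h w) t = map_tuple h t by rewrite ht.
  apply: eq_from_tnth => j; rewrite !tnth_map window_map_out //.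
  by have := ltn_ord w; lia.
rewrite big_split /= leq_add2l exchange_big /=.
apply: (@leq_trans (\sum_(j < arity i) m)).
  by apply: leq_sum => j _; apply: count_windows.
by rewrite sum_nat_const card_ord mulnC (bigD1 i) //= leq_addr.
Qed.

Lemma window_map_good (L : listing sigma) (h : {ffun struct_of L -> B}) v :
  m <= ldom L -> forall W, W = (ldom L - m).+1 ->
  (forall w, w < W -> csp_value (window_map h w) <= v) ->
  W * csp_value h <= W * v + m * K * csp_value h.
Proof.
move=> le_m W WE le_v; apply: leq_trans (window_map_average h le_m WE) _.
rewrite leq_add2r -[X in _ <= X * _]card_ord -sum_nat_const.
by apply: leq_sum => w _; apply: le_v.
Qed.

End Averaging.

Lemma is_opt_exists (sigma : signature) (B : structure sigma)
    (I : inst (Max_Sur_CSP B)) (s : sol I) : exists v, is_opt I v.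
Proof.
have [s' _ max_s'] := @arg_maxnP _ s xpredT (@value (Max_Sur_CSP B) I) isT.
exists (@value (Max_Sur_CSP B) I s'); split; first by exists s'.
by move=> t; apply: max_s'.
Qed.

(** Dividing by W gives (1 - eps) h <= v. For eps <= 1 this yields (1 - eps) r opt <= v, and (1 -
    eps) r >= r - eps as r <= 1. For eps > 1 the left-hand side is not positive. *)
Lemma window_bound (R : realFieldType) (r eps : R) (W C opt v h : nat) :
  (0 < W)%N -> (0 <= r <= 1)%R -> (C%:R <= W%:R * eps)%R ->
  (W * h <= W * v + C * h)%N -> (r * opt%:R <= h%:R)%R ->
  ((r - eps) * opt%:R <= v%:R :> R)%R.
Proof.
move=> W0 /andP[r0 r1] CW; rewrite -(ler_nat R) natrD !natrM => le rh.
have W0' : (0 < W%:R :> R)%R by rewrite ltr0n.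
have h0 : (0 <= h%:R :> R)%R by [].
have o0 : (0 <= opt%:R :> R)%R by [].
have v0 : (0 <= v%:R :> R)%R by [].
have le' : (h%:R * (1 - eps) <= v%:R :> R)%R.
  rewrite -(ler_pM2l W0').
  have := ler_wpM2r h0 CW; lra.
have [e1|e1] := lerP eps 1.
  have e1' : (0 <= 1 - eps)%R by rewrite subr_ge0.
  apply: le_trans le'.
  apply: le_trans (ler_wpM2r e1' rh).
  have C0 : (0 <= C%:R :> R)%R by [].
  have e0 : (0 <= eps)%R.
    by rewrite -(pmulr_rge0 _ W0'); apply: le_trans CW.
  have : (0 <= opt%:R * (eps * (1 - r)))%R by rewrite !mulr_ge0 // subr_ge0.
  lra.
apply: le_trans v0; rewrite mulr_le0_ge0 //; lra.
Qed.

(** A positive rational is at least the inverse of its denominator. *)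
Lemma mul_den_leq (eps : rat) (C W : nat) :
  (0 < eps)%R -> C * `|denq eps|%N <= W -> (C%:R <= W%:R * eps :> rat)%R.
Proof.
move=> e0 leW; have := leW; rewrite -(ler_nat rat) natrM => leW'.
have den : (`|denq eps|%N%:R = (denq eps)%:~R :> rat)%R.
  by rewrite -[in RHS]absz_denq.
have num1 : (1 <= eps * (denq eps)%:~R)%R.
  by rewrite -numqE ler1z -gtz0_ge1 numq_gt0.
have C0 : (0 <= C%:R :> rat)%R by [].
apply: (@le_trans _ _ (C%:R * (eps * (denq eps)%:~R))%R); first by rewrite ler_peMr.
rewrite mulrCA mulrC ler_pM2r //; rewrite den in leW'.
exact: leW'.
Qed.

(** * The algorithm and its guarantee *)

Section Approximation.
Variables (sigma : signature) (B : structure sigma) (b0 : B).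
Let m := #|B|.
Let K := \sum_(i < nsym sigma) arity i.

(** The power of two exceeds the denominator. The part with factor [m * K] pays for the averaging
    argument, and the additional [m] for the n - m in the number of windows. *)
Definition threshold (eps : rat) : nat :=
  m * K.+1 * 2 ^ size (bits `|denq eps|).

Definition candidates (n : nat) (eps : rat) (l : seq B) : seq (seq B) :=
  if threshold eps < n then windows (enum B) l
  else rev [seq k <- words (enum B) n | all (mem k) (enum B)].

Definition graph_value (L : listing sigma) (k : seq B) : nat :=
  csp_value (of_graph b0 (ldom L) k : {ffun struct_of L -> B}).

Definition best (L : listing sigma) (eps : rat) (l : seq B) : seq B :=
  let s := candidates (ldom L) eps l in
  argmax (graph_value L) (head [::] s) (behead s).

Lemma threshold_window n eps : threshold eps < n ->
  m * K * `|denq eps| <= (n - m).+1.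
Proof.
have := bitval_take_lt (bits `|denq eps|) (size (bits `|denq eps|)).
rewrite take_size bits_val /threshold.
set d := absz _; set e := 2 ^ _ => lt_d; rewrite mulnS mulnDl => lt_n.
have : m * K * d <= m * K * e by rewrite leq_mul2l ltnW ?orbT.
have : m <= m * e by rewrite leq_pmulr // expn_gt0.
lia.
Qed.

Lemma mem_windows (T : eqType) (w l k : seq T) :
  reflect (exists2 j, j <= size l - size w & k = window w l j)
          (k \in windows w l).
Proof.
rewrite mem_rev; apply: (iffP mapP) => [[j + ->]|[j le_j ->]].
  by rewrite mem_iota => le_j; exists j.
by exists j; rewrite ?mem_iota.
Qed.

Lemma candidates_sol n eps l k :
  m <= n -> size l = n -> k \in candidates n eps l ->
  size k = n /\ all (mem k) (enum B).
Proof.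
move=> le_m sl; rewrite /candidates; case: ifP => _.
  case/mem_windows => j; rewrite sl -cardE -/m => le_j ->; split.
    by rewrite size_window ?sl // -cardE -/m; lia.
  by apply/allP => b bB; rewrite /= /window !mem_cat bB orbT.
by rewrite mem_rev mem_filter mem_words => /andP[-> /andP[/eqP-> _]].
Qed.

Lemma candidates_neq0 n eps l : m <= n -> candidates n eps l != [::].
Proof.
move=> le_m; rewrite /candidates; case: ifP => _.
  by rewrite -size_eq0 size_rev size_map size_iota.
rewrite -size_eq0 size_rev size_filter -lt0n -has_count; apply/hasP.
exists (enum B ++ nseq (n - m) b0).
  rewrite mem_words size_cat size_nseq -cardE subnKC // eqxx.
  by apply/allP => b _; rewrite /= mem_enum.
by apply/allP => b bB; rewrite /= mem_cat bB.
Qed.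

Lemma best_mem L eps l :
  m <= ldom L -> best L eps l \in candidates (ldom L) eps l.
Proof.
move=> le_m; have := candidates_neq0 eps l le_m; rewrite /best.
by case: candidates => // k s _; apply: argmax_mem.
Qed.

Lemma best_max L eps l k :
  k \in candidates (ldom L) eps l ->
  graph_value L k <= graph_value L (best L eps l).
Proof.
rewrite /best; case: candidates => // k' s; exact: leq_argmax.
Qed.

(** A surjective map is in particular a solution of [Max_CSP B], so [v] is at most that optimum and
    r v <= value of [h]. Above the threshold [window_bound] applies with [v] as optimum. Below it
    every surjective map is a candidate. *)
Lemma best_approximate (r eps : rat) (L : inst (Max_CSP B)) (h : sol L) v :
  (0 <= r <= 1)%R -> (0 < eps)%R -> m <= ldom L ->
  @approximate (Max_CSP B) r L h ->
  (exists2 g : {ffun struct_of L -> B}, surjective g & csp_value g = v) ->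
  ((r - eps) * v%:R <=
     (graph_value L (best L eps (graph (h : {ffun 'I_(ldom L) -> B}))))%:R)%R.
Proof.
move=> r01 e0 le_m [opt [_ le_opt] rh] [g sg gv].
set l := graph _; set best_v := graph_value _ _.
have [lt_n|le_n] := ltnP (threshold eps) (ldom L); last first.
  have le_v : v <= best_v.
    rewrite -gv -[g](graphK b0); apply: best_max.
    rewrite /candidates ltnNge le_n mem_rev mem_filter mem_words size_graph eqxx /=.
    rewrite -surjectiveE sg; apply/allP => b _; exact: mem_enum.
  apply: (@le_trans _ _ v%:R%R); last by rewrite ler_nat.
  have /andP[_ r1] := r01; have v0 : (0 <= v%:R :> rat)%R by [].
  by rewrite ler_piMl //; lra.
have le_v : (r * v%:R <= (csp_value h)%:R)%R.
  apply: le_trans rh; have /andP[r0 _] := r01; apply: ler_wpM2l => //.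
  by rewrite ler_nat -gv; apply: le_opt.
apply: (window_bound (W := (ldom L - m).+1) (C := m * K) _ r01 _ _ le_v) => //.
  exact: mul_den_leq e0 (threshold_window lt_n).
have good := @window_map_good _ B b0 L h best_v le_m _ erefl.
apply: good => w lt_w.
apply: best_max; rewrite /candidates lt_n; apply/mem_windows; exists w => //.
by rewrite size_graph -cardE.
Qed.

End Approximation.

(** The index contains the graph of the map returned by [p], and [D] records that [p] returns it, so
    [p] can be called as a subprogram. In [sz], the threshold pays for its unary form and the
    exponential for exhaustive search. Both are constants once eps is fixed. *)
Lemma ptime_best (sigma : signature) (B : structure sigma) (b0 : B) p k :
  NPO (Max_CSP B) ->
  let D (z : inst (Max_CSP B) * seq B * rat) :=
    [/\ #|B| <= ldom z.1.1, size z.1.2 = ldom z.1.1 &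
        runs_within p k (isize z.1.1) (enc_inst z.1.1)
          (tlist (map (@enc_elt B) z.1.2))] in
  let sz (z : inst (Max_CSP B) * seq B * rat) :=
    isize z.1.1 + tree_size (enc_rat z.2) + threshold B z.2
    + #|B|.+1 ^ threshold B z.2 in
  ptime D sz (fun z => Node (enc_inst z.1.1) (enc_rat z.2))
    (fun z => tlist (map (@enc_elt B) (best b0 z.1.1 z.2 z.1.2))).
Proof.
move=> npoB D sz; set src := fun z => Node _ _.
have m_gt0 : 0 < #|B| by apply/card_gt0P; exists b0.
have sz_isize D' : pbd D' sz (fun z => isize z.1.1).
  by apply: (pbd_le (pbd_sz _ sz)) => z _; rewrite /sz; lia.
have sizeI D' : psize D' sz (fun z => enc_inst z.1.1).
  have [j size_j] := npo_isize npoB.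
  by apply: (pbd_le (pbd_pbound j (sz_isize D'))) => z _; have [] := size_j z.1.1.
have aa : ptime D sz src src.
  apply/ptime_id/(pbd_le (pbd_add (sizeI D)
    (pbd_add (pbd_sz _ sz) (pbd_const _ _ 1)))).
  by move=> z _; rewrite /sz /=; lia.
have inst_src := ptime_fst aa.
have dom_src := ptime_fst inst_src.
have thr_src : ptime D sz src (fun z => enc_unary (threshold B z.2)).
  have bits_src := ptime_ext (ptime_snd (ptime_snd aa)) (fun z _ => enc_binaryE _).
  have := ptime_double_unary (c := #|B| * (\sum_(i < nsym sigma) arity i).+1)
    bits_src.
  rewrite /threshold => H.
  apply: ptime_ext (H _) _ => [|z _]; last by rewrite size_map.
  apply: (pbd_le (pbd_sz _ sz)) => z _; rewrite size_map -/(threshold B z.2).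
  by rewrite /sz; lia.
have sol_src : ptime D sz src (fun z => tlist (map (@enc_elt B) z.1.2)).
  apply: (ptime_seq inst_src); exists p, (fun z => pbound k (isize z.1.1)).
  by split; [apply/pbd_pbound/sz_isize|move=> z []].
have big : ptime (fun z => D z /\ threshold B z.2 < ldom z.1.1) sz src
    (fun z => tlist (map (enc_seq id) (windows (map (@enc_elt B) (enum B))
       (map (@enc_elt B) z.1.2)))).
  apply: ptime_windows (ptime_andl sol_src); rewrite size_map -cardE //.
  by move=> z [[le_m sl _] _]; rewrite size_map sl.
have small : ptime (fun z => D z /\ ~~ (threshold B z.2 < ldom z.1.1)) sz src
    (fun z => tlist (map (enc_seq id)
       (rev [seq l <- words (map (@enc_elt B) (enum B)) (ldom z.1.1)
            | all (mem l) (map (@enc_elt B) (enum B))]))).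
  apply: ptime_filter_sub; apply: ptime_words (ptime_andl dom_src) _.
  apply: (pbd_le (pbd_sz _ sz)) => z [_]; rewrite -leqNgt => le_n.
  rewrite size_map -cardE; apply: (@leq_trans (#|B|.+1 ^ threshold B z.2)).
    by rewrite leq_pexp2l.
  by rewrite /sz leq_addl.
have cands : ptime D sz src
    (fun z => tlist (map (fun l => tlist (map (@enc_elt B) l))
                         (candidates (ldom z.1.1) z.2 z.1.2))).
  apply: ptime_ext (ptime_if (ptime_ltn_unary thr_src dom_src) big small) _ => z _.
  rewrite /candidates; case: ifP => _.
    by rewrite map_windows -map_comp.
  rewrite map_words filter_map -map_rev -map_comp; congr (tlist (map _ (rev _))).
  apply: eq_filter => l; rewrite /= all_map; apply: eq_all => b.
  by rewrite /= mem_map //; apply: enc_elt_inj.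
have [pv [kv run_pv]] := npo_value npoB.
pose Y := {L : inst (Max_CSP B) & sol L}.
have run_v : ptime (fun=> True) (fun y : Y => isize (projT1 y))
    (fun y => Node (enc_inst (projT1 y)) (enc_sol (projT2 y)))
    (fun y => enc_binary (value (projT2 y))).
  by apply/ptime_runs; exists pv, kv => y _; apply: run_pv.
pose C (z : inst (Max_CSP B) * seq B * rat) := candidates (ldom z.1.1) z.2 z.1.2.
have CE z : D z -> head [::] (C z) :: behead (C z) = C z.
  case=> le_m _ _; have := candidates_neq0 b0 z.2 z.1.2 le_m.
  by rewrite -/(C z); case: (C z).
apply: (ptime_argmax (enc := fun l => tlist (map (@enc_elt B) l))
  (v := fun z => graph_value b0 z.1.1) (x := fun z => head [::] (C z))
  (s := fun z => behead (C z)) inst_src).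
  by apply: ptime_ext cands _ => z Dz; rewrite -/(C z) CE.
(* Candidates are lists while the program for values is specified on maps. A candidate has the
   length of the domain, so it is the graph of the map read from it and the encodings coincide. *)
pose g (y : inst (Max_CSP B) * seq B * rat * seq B) : Y :=
  existT _ y.1.1.1 (of_graph b0 (ldom y.1.1.1) y.2).
have := ptime_reindex (g := g) (sz' := fun y => sz y.1)
  (D' := fun y => D y.1 /\ y.2 \in head [::] (C y.1) :: behead (C y.1))
  run_v (fun _ _ => Logic.I).
move=> H; apply: ptime_ext_in (H _) _.
  by apply: (pbd_reindex (sz_isize D) (g := fst)) (pbd_sz _ _) => y [].
move=> [z l] [/= Dz]; rewrite CE // => lC; congr Node.
case: Dz => le_m sl _; have [szl _] := candidates_sol le_m sl lC.
by rewrite enc_mapE of_graphK.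
Qed.

Lemma surjective_scheme (sigma : signature) (B : structure sigma) (b0 : B)
    (r : rat) p k :
  NPO (Max_CSP B) -> (0 <= r <= 1)%R ->
  (forall I : inst (Max_CSP B), exists2 s : sol I,
     runs_within p k (isize I) (enc_inst I) (enc_sol s) & approximate r s) ->
  exists q, forall eps : rat, (0 < eps)%R ->
    exists j, forall I : inst (Max_Sur_CSP B), exists2 s : sol I,
      runs_within q j (isize I) (Node (enc_inst I) (enc_rat eps)) (enc_sol s)
      & approximate (r - eps)%R s.
Proof.
move=> npoB r01 alg.
have [q [T [[c T_c] q_T]]] := ptime_best b0 p k npoB.
exists q => eps e0.
(* Everything in the bound that depends only on eps. The program [q] is already chosen, and only the
   polynomial varies with eps. *)
pose C := tree_size (enc_rat eps) + threshold B eps + #|B|.+1 ^ threshold B eps + 2.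
have /pbd_pboundP[j le_j] :
    pbd (fun=> True) (@isize (Max_Sur_CSP B)) (fun I => (isize I + C) ^ c).
  by apply/pbd_exp/pbd_add; [apply: pbd_sz|apply: pbd_const].
exists j => -[L leL].
pose I : inst (Max_Sur_CSP B) :=
  exist (fun L => is_true (#|B| <= #|struct_of L|)) L leL.
have le_m : #|B| <= ldom L by rewrite -[ldom L]card_ord.
have [h run_h apx_h] := alg L.
pose l : seq B := graph (h : {ffun 'I_(ldom L) -> B}).
have sl : size l = ldom L by apply: size_graph.
have [szb surb] := candidates_sol le_m sl (best_mem b0 eps l le_m).
pose g : {ffun struct_of L -> B} := of_graph b0 (ldom L) (best b0 L eps l).
have gE : graph (g : {ffun 'I_(ldom L) -> B}) = best b0 L eps l by apply: of_graphK.
have sg : surjective g by rewrite surjectiveE gE.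
pose s : sol I := exist (fun f => is_true (surjective f)) g sg.
exists s.
  have [|t run_t t_T] := q_T (L, l, eps).
    by split=> //=; rewrite -enc_mapE.
  exists t; first by rewrite /= enc_mapE gE.
  apply: leq_trans t_T _; apply: leq_trans (T_c (L, l, eps) _) _.
    by split=> //=; rewrite -enc_mapE.
  by apply: leq_trans (le_j I Logic.I); rewrite /C !addnA.
have [v [[[f sf] fv] le_v]] := is_opt_exists s.
exists v; first by split=> //; exists (exist _ f sf).
apply: (best_approximate b0 r01 e0 le_m apx_h).
by exists f.
Qed.

(** An instance with one element and empty relations has a solution only if [B] has an element. This
    supplies the default [b0]. *)
Lemma target_inhabited (sigma : signature) (B : structure sigma) :
  (forall L : inst (Max_CSP B), exists s : sol L, True) -> exists b : B, True.
Proof.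
have nil_uniq : [forall i : 'I_(nsym sigma),
    uniq ((fun=> [::]) i : seq ((arity i).-tuple 'I_1))] by apply/forallP.
by move=> /(_ (Listing nil_uniq))[h _]; exists (h (ord0 : 'I_1)).
Qed.

Theorem theorem3 (sigma : signature) (B : structure sigma) :
  PO (Max_CSP B) \/ APX_complete (Max_CSP B) ->
  PTAS (Max_Sur_CSP B) \/ APX_complete (Max_Sur_CSP B).
Proof.
case=> [[npoB [p [k alg]]]|[[npoB [r r01 [p [k alg]]]] hard]].
  left; split; first exact: NPO_surjective.
  have [b0 _] : exists b : B, True.
    by apply: target_inhabited => L; have [h _ _] := alg L; exists h.
  have [|I|q scheme] := @surjective_scheme sigma B b0 1%R p k npoB.
  - by rewrite ler01 lexx.
  - have [s run_s opt_s] := alg I; exists s => //.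
    (* Optimality is approximation with ratio 1. *)
    by exists (value s); rewrite ?mul1r.
  - by exists q.
right; have npoS := NPO_surjective npoB.
have [b0 _] : exists b : B, True.
  by apply: target_inhabited => L; have [h _ _] := alg L; exists h.
have /andP[r0 r1] := r01.
split; last first.
  by move=> Q apxQ; apply: AP_reducible_surjective (hard Q apxQ); case: apxQ.
(* Taking eps = r / 2 leaves the positive ratio r - r / 2 = r / 2. *)
split=> //; exists (r / 2)%R; first by lra.
have [|q scheme] := surjective_scheme b0 npoB _ alg; first by lra.
have [|j q_j] := scheme (r / 2)%R; first by lra.
have [i size_i] := npo_isize npoS.
have aa : ptime (fun=> True) (@isize (Max_Sur_CSP B)) enc_inst enc_inst.
  apply/ptime_id/(pbd_le (pbd_pbound i (pbd_sz _ _))) => I _.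
  by have [] := size_i I.
(* An algorithm for APX receives the instance alone, so the constant code of r / 2 is attached to it
   before the scheme is run. *)
have [p' [T [[c T_c] p'_T]]] := ptime_pair aa (ptime_const (enc_rat (r / 2)) aa).
have /pbd_pboundP[c' le_c'] : pbd (fun=> True) (@isize (Max_Sur_CSP B))
    (fun I => T I + pbound j (isize I) + 1).
  apply: pbd_add (pbd_const _ _ 1); apply: pbd_add; first by exists c.
  exact/pbd_pbound/pbd_sz.
exists (PSeq p' q), c' => I.
have [s [t run_t t_j] apx_s] := q_j I; exists s; last first.
  by rewrite (_ : r / 2 = r - r / 2)%R //; lra.
have [u run_u u_T] := p'_T I Logic.I.
exists (u + t).+1; first exact: run_seq run_u run_t.
by have := le_c' I Logic.I; lia.
Qed.
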